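(* Let $r,s,k \in \mathbb{N}_0 \cup \{\infty\}$ with $k \geq r+s$. Assume that $U \subseteq E_1$, $V \subseteq E_2$ and $P \subseteq E_3$ are locally convex subsets with dense interior of locally convex spaces $E_1,E_2,E_3$. Let $E_4$ be another locally convex space, $f \colon U \times V \rightarrow P$ a map of class $C^{r,s}$ and $g \colon U \times P \rightarrow E_4$ a map of class $C^{r,k}$. Then $$g \circ (\mathrm{pr}_U , f) \colon U \times V \rightarrow E_4,\quad (x,y) \mapsto g(x,f(x,y))$$ is a map of class $C^{r,s}$, where $\mathrm{pr}_U \colon U \times V \rightarrow U$ is the canonical projection.
   Context: Locally convex spaces are real Hausdorff locally convex topological vector spaces. A subset $U$ of a locally convex space $E$ is called locally convex if every $x\in U$ has a convex neighbourhood in $U$. ''With dense interior'' means that the interior $U^\circ$ is dense in $U$. Convention: $r+s=\infty$ if $r=\infty$ or $s=\infty$. $D_hf(z):=\lim_{t\to0}t^{-1}(f(z+th)-f(z))$ denotes the directional derivative. $C^{r,s}$-maps: For $U\subseteq E_1$, $V\subseteq E_2$ open, $f\colon U\times V\to F$ ($F$ a locally convex space) is $C^{r,s}$ if for all $i,j\in\mathbb{N}_0$ with $i\le r$, $j\le s$ the iterated directional derivative $d^{(i,j)}f(x,y,w_1,\dots,w_i,v_1,\dots,v_j):=(D_{(w_i,0)}\cdots D_{(w_1,0)}D_{(0,v_j)}\cdots D_{(0,v_1)}f)(x,y)$ exists everywhere and $d^{(i,j)}f\colon U\times V\times E_1^i\times E_2^j\to F$ is continuous. If $U,V$ are locally convex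 subsets with dense interior, $f$ is $C^{r,s}$ if $f|_{U^\circ\times V^\circ}$ is $C^{r,s}$ and each $d^{(i,j)}(f|_{U^\circ\times V^\circ})$ extends to a continuous map $d^{(i,j)}f\colon U\times V\times E_1^i\times E_2^j\to F$ (with $d^{(0,0)}f=f$). A map into a subset $P\subseteq E_3$ is $C^{r,s}$ if it is $C^{r,s}$ as a map into $E_3$. *)

(* Defs.v *)
From HB Require Import structures.
From mathcomp Require Import all_boot all_order all_algebra.
From mathcomp Require Import all_classical all_reals all_analysis.

Set Implicit Arguments.
Unset Strict Implicit.
Unset Printing Implicit Defensive.

Import Order.TTheory GRing.Theory Num.Theory.
Import numFieldNormedType.Exports.

Local Open Scope classical_set_scope.
Local Open Scope ring_scope.

(* Elements of N_0 u {oo}. *)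
Variant enat := ENat of nat | EInf.

Definition enat_add (r s : enat) : enat :=
  match r, s with
  | ENat m, ENat n => ENat (m + n)%N
  | _, _ => EInf
  end.

Definition enat_le (r s : enat) : bool :=
  match r, s with
  | _, EInf => true
  | ENat m, ENat n => (m <= n)%N
  | EInf, ENat _ => false
  end.

Section Subsets.
Context {R : realType} {E : tvsType R}.

(* The convex neighbourhood C of x is a neighbourhood in the topology induced
   on U, hence the filter [within U (nbhs x)]. *)
Definition locally_convex_subset (U : set E) : Prop :=
  forall x, U x ->
    exists C : set E, [/\ convex_set C, C `<=` U & within U (nbhs x) C].

Definition dense_interior (U : set E) : Prop := U `<=` closure U°.

End Subsets.

(* The library's [derive] and [derivable] are restricted to normed modules. *)
Section DirectionalDerivatives.
Context {R : realType} {E F : tvsType R}.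

Definition dquot (f : E -> F) (z h : E) : R -> F :=
  fun t => t^-1 *: (f (z + t *: h) - f z).

Definition ddir_exists (f : E -> F) (z h : E) : Prop :=
  exists l : F, dquot f z h t @[t --> 0^'] --> l.

(* The limit of the difference quotients, with the value 0 where it does not
   exist. *)
Definition ddir (h : E) (f : E -> F) : E -> F :=
  fun z => xget 0 [set l : F | dquot f z h t @[t --> 0^'] --> l].

(* For hs = [:: h_1; ...; h_n] this is D_(h_n) ... D_(h_1) f. *)
Fixpoint ddirs (hs : seq E) (f : E -> F) : E -> F :=
  if hs is h :: hs' then ddirs hs' (ddir h f) else f.

(* Each of the successive derivatives D_(h_m) ... D_(h_1) f exists at every
   point of O. *)
Fixpoint ddirs_exist (O : set E) (hs : seq E) (f : E -> F) : Prop :=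
  if hs is h :: hs' then
    (forall z, O z -> ddir_exists f z h) /\ ddirs_exist O hs' (ddir h f)
  else True.

End DirectionalDerivatives.

Section Crs.
Context {R : realType} {E1 E2 F : tvsType R}.

Definition tpow (E : tvsType R) (i : nat) := prod_topology (fun _ : 'I_i => E).

Definition dirs (i j : nat) (w : tpow E1 i) (v : tpow E2 j) : seq (E1 * E2) :=
  [seq (0, v l) | l <- enum 'I_j] ++ [seq (w l, 0) | l <- enum 'I_i].

Definition dij (i j : nat) (f : E1 * E2 -> F)
    (p : E1 * E2 * tpow E1 i * tpow E2 j) : F :=
  ddirs (dirs p.1.2 p.2) f p.1.1.

Definition dij_dom (i j : nat) (U : set E1) (V : set E2) :
    set (E1 * E2 * tpow E1 i * tpow E2 j) :=
  U `*` V `*` setT `*` setT.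

(* Maps on U x V are represented by total functions on E1 * E2; only their
   values on U x V matter below. *)
Definition Crs_open (r s : enat) (U : set E1) (V : set E2)
    (f : E1 * E2 -> F) : Prop :=
  forall i j : nat, enat_le (ENat i) r -> enat_le (ENat j) s ->
    (forall (w : tpow E1 i) (v : tpow E2 j),
        ddirs_exist (U `*` V) (dirs w v) f) /\
    {within dij_dom U V, continuous (@dij i j f)}.

Definition Crs (r s : enat) (U : set E1) (V : set E2)
    (f : E1 * E2 -> F) : Prop :=
  Crs_open r s U° V° f /\
  forall i j : nat, enat_le (ENat i) r -> enat_le (ENat j) s ->
    exists d : E1 * E2 * tpow E1 i * tpow E2 j -> F,
      [/\ {within dij_dom U V, continuous d},
          {in dij_dom U° V°, d =1 dij f} &
          (i = 0)%N -> (j = 0)%N -> {in dij_dom U V, forall p, d p = f p.1.1}].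

End Crs.

(* Main.v *)
Require Import Defs.
From HB Require Import structures.
From mathcomp Require Import all_boot all_order all_algebra.
From mathcomp Require Import all_classical all_reals all_analysis.
From mathcomp Require Import ring lra zify.

Set Implicit Arguments.
Unset Strict Implicit.
Unset Printing Implicit Defensive.

Import Order.TTheory GRing.Theory Num.Theory.
Import numFieldNormedType.Exports.

Local Open Scope classical_set_scope.
Local Open Scope ring_scope.

(** Write [h (x, y) := g (x, f (x, y))].  As in the formula of Faa di Bruno,
every iterated directional derivative of [h] is a finite sum of terms

  d^(a,b) g (x, f (x, y), w_A, phi_1, ..., phi_b)

where [w_A] is a list of directions in [E1] and every [phi_m] is itself a
derivative of [f] at [(x, y)].  Differentiating such a term in a direction
[(w, 0)] or [(0, v)] gives more terms of this shape: [g] is differentiated in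
its first variable, in its second variable along the derivative of [f], or one
of the [phi_m] is differentiated.  A term obtained by differentiating [n] times
in [E1] and [m] times in [E2] has [a <= n] and [b <= n + m], so that
[r + s <= k] keeps all the derivatives of [g] within reach.  Since all the
derivatives of [f] and [g] extend continuously to [U `*` V] and [U `*` P], the
same formula defines the continuous extension of the derivatives of [h].

The difficulty is that [f] may send interior points of [U `*` V] to boundary
points of [P], where [g] has no derivatives, only their continuous extensions.
The chain rule needed there is [chain_rule_boundary].  Both sides of the
difference quotient are contracted towards an interior point of a convex
neighbourhood; the segment between the contracted points consists of interior
points, on which the mean value theorem applies, and the contraction is then
undone by continuity.

All the mean value arguments are done without integrals or functionals: if the
derivatives of a curve lie in an open convex set, then so do its difference
quotients ([dquot_in_convex]).  From this follow the additivity of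
derivatives in the direction ([has_ddir_dirD]) and Schwarz' theorem
([has_ddir_swap]).  The latter is needed because the derivatives in the second
variable come first in [d^(a,b) g], whereas a term with [a > 0] still has to be
differentiated in the second variable ([jet_ddir_snd]).  The moving arguments
[phi_m] are handled by the linearity of [d^(a,b) g] in each of them
([jet_lin], [jet_chain_slots]).  The bookkeeping of the terms is symbolic
([dterm], [term_le], [eval_term]). *)

(** * Limits and convex sets in locally convex spaces *)

Lemma cvg_to_within {T : Type} {X : topologicalType} {Fl : set_system T}
    {FF : Filter Fl} (A : set X) (u : T -> X) (x : X) :
  (\forall t \near Fl, A (u t)) -> u @ Fl --> x ->
  u @ Fl --> within A (nbhs x).
Proof.
move=> uA ux W; rewrite /within/= => /ux /=; rewrite !nbhs_simpl/= => uW.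
by apply: filterS (filterI uA uW) => t [Aut]; apply.
Qed.

Lemma cvg_pair_nbhs {T : Type} {X Y : topologicalType} {Fl : set_system T}
    {FF : Filter Fl} (u : T -> X) (v : T -> Y) (x : X) (y : Y) :
  u @ Fl --> x -> v @ Fl --> y -> (fun t => (u t, v t)) @ Fl --> (x, y).
Proof. by move=> ux vy; exact: cvg_pair ux vy. Qed.

Section TvsLimits.
Context {R : realType} {E : tvsType R}.

Lemma tvs_cvgD {T : Type} {Fl : set_system T} {FF : Filter Fl} (f g : T -> E)
    (a b : E) :
  f @ Fl --> a -> g @ Fl --> b -> (fun x => f x + g x) @ Fl --> a + b.
Proof.
move=> fa gb.
apply: (@cvg_comp _ _ _ (fun x => (f x, g x)) (fun x : E * E => x.1 + x.2)).
  exact: cvg_pair fa gb.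
exact: (@add_continuous E (a, b)).
Qed.

Lemma tvs_cvgN {T : Type} {Fl : set_system T} {FF : Filter Fl} (f : T -> E)
    (a : E) :
  f @ Fl --> a -> (fun x => - f x) @ Fl --> - a.
Proof. by move=> fa; apply: (@cvg_comp _ _ _ f -%R _ _ _ fa);
  exact: (@opp_continuous E a).
Qed.

Lemma tvs_cvgB {T : Type} {Fl : set_system T} {FF : Filter Fl} (f g : T -> E)
    (a b : E) :
  f @ Fl --> a -> g @ Fl --> b -> (fun x => f x - g x) @ Fl --> a - b.
Proof. by move=> fa gb; apply: tvs_cvgD => //; exact: tvs_cvgN. Qed.

Lemma tvs_cvgZ {T : Type} {Fl : set_system T} {FF : Filter Fl}
    (k : T -> R) (f : T -> E) (c : R) (a : E) :
  k @ Fl --> c -> f @ Fl --> a -> (fun x => k x *: f x) @ Fl --> c *: a.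
Proof.
move=> kc fa.
apply: (@cvg_comp _ _ _ (fun x => (k x : R^o, f x))
    (fun x : R^o * E => x.1 *: x.2)).
  exact: cvg_pair kc fa.
exact: (@scale_continuous R E (c : R^o, a)).
Qed.

Lemma tvs_cvg_sum {T : Type} {I : eqType} {Fl : set_system T} {FF : Filter Fl} (s : seq I)
    (f : I -> T -> E) (a : I -> E) :
  (forall i, i \in s -> f i @ Fl --> a i) ->
  (fun x => \sum_(i <- s) f i x) @ Fl --> \sum_(i <- s) a i.
Proof.
elim: s => [|i s IH] H /=.
  rewrite big_nil; under eq_fun do rewrite big_nil; exact: cvg_cst.
rewrite big_cons; under eq_fun do rewrite big_cons.
apply: tvs_cvgD; first by apply: H; rewrite mem_head.
by apply: IH => j js; apply: H; rewrite in_cons js orbT.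
Qed.

Lemma cvg_dnbhs_id : t @[t --> (0 : R)^'] --> (0 : R).
Proof. exact: cvg_within_filter. Qed.

Lemma cvg_line (z h : E) : z + t *: h @[t --> (0 : R)^'] --> z.
Proof.
rewrite -[X in _ --> X]addr0 -(scale0r h).
apply: tvs_cvgD; first exact: cvg_cst.
by apply: tvs_cvgZ; [exact: cvg_dnbhs_id|exact: cvg_cst].
Qed.

Lemma nbhs_line (z h : E) (N : set E) :
  nbhs z N -> \forall t \near (0 : R)^', N (z + t *: h).
Proof. exact: cvg_line. Qed.

Lemma cvg_of_quotient (g : R -> E) (l : E) :
  t^-1 *: (g t - g 0) @[t --> (0 : R)^'] --> l -> g @ (0 : R)^' --> g 0.
Proof.
move=> gl.
have H : g 0 + t *: (t^-1 *: (g t - g 0)) @[t --> (0 : R)^'] --> g 0 + 0 *: l.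
  apply: tvs_cvgD; first exact: cvg_cst.
  by apply: tvs_cvgZ => //; exact: cvg_dnbhs_id.
rewrite scale0r addr0 in H; apply: cvg_trans H; apply: near_eq_cvg; near=> t.
have t0 : t != 0 by near: t; exact: nbhs_dnbhs_neq.
by rewrite scalerA mulfV// scale1r addrC subrK.
Unshelve. all: by end_near. Qed.

Lemma closure_lim {T : Type} {Fl : set_system T} {FF : ProperFilter Fl}
    (u : T -> E) (l : E) (K : set E) :
  u @ Fl --> l -> (\forall x \near Fl, K (u x)) -> closure K l.
Proof.
move=> ul uK N lN.
have H : Fl ((fun x => K (u x)) `&` (u @^-1` N)) by apply: filterI uK (ul N lN).
by have [x [Kx Nx]] := filter_ex H; exists (u x).
Qed.

End TvsLimits.

Lemma cvg_pair_quotient {R : realType} (X Y : tvsType R) (a : R -> X) (b : R -> Y)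
    (x : X) (y : Y) :
  t^-1 *: (a t - a 0) @[t --> (0 : R)^'] --> x ->
  t^-1 *: (b t - b 0) @[t --> (0 : R)^'] --> y ->
  (fun t => t^-1 *: (((a t, b t) : X * Y) - (a 0, b 0))) @ (0 : R)^'
    --> ((x, y) : X * Y).
Proof. by move=> ax b_y; exact: cvg_pair_nbhs ax b_y. Qed.

Section Convexity.
Context {R : realType} {E : tvsType R}.

(** An affine form of convexity that avoids the type of scalars in [0, 1]. *)
Lemma convex_setP (A : set E) : convex_set A ->
  forall (x y : E) (t : R), 0 <= t <= 1 -> A x -> A y -> A (x + t *: (y - x)).
Proof.
move=> cA x y t /andP[t0 t1] Ax Ay.
have t0' : 0 <= 1 - t by rewrite subr_ge0.
have t1' : 1 - t <= 1 by rewrite gerBl.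
have := cA x y (Itv01 t0' t1') (mem_set Ax) (mem_set Ay).
rewrite inE /conv /=; congr (A _).
rewrite /unstable.onem subKr scalerBr scalerBl scale1r.
by rewrite -!addrA; congr (_ + _); rewrite addrC.
Qed.

Lemma convex_set_of (A : set E) :
  (forall (x y : E) (t : R), 0 <= t <= 1 -> A x -> A y -> A (x + t *: (y - x))) ->
  convex_set A.
Proof.
move=> cA x y l /set_mem Ax /set_mem Ay; apply/mem_set.
have := cA y x l%:num; rewrite ge0 le1 => /(_ isT Ay Ax); congr (A _).
rewrite /conv /= /unstable.onem scalerBl scale1r scalerBr.
by rewrite addrCA.
Qed.

Lemma convex_nbhs (x : E) (N : set E) : nbhs x N ->
  exists K : set E, [/\ open K, convex_set K, K x & K `<=` N].
Proof.
move=> xN; have [B Bc [Bo Bb]] := @locally_convex R E.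
have [K [BK Kx] KN] := Bb x N xN.
by exists K; split => //; [exact: Bo|apply: Bc; exact/mem_set].
Qed.

(** Closures of open convex neighbourhoods suffice because uniform spaces are
regular. *)
Lemma cvg_convex_closure {T : Type} {Fl : set_system T} {FF : Filter Fl}
    (f : T -> E) (l : E) :
  (forall K : set E, open K -> convex_set K -> K l ->
    \forall t \near Fl, closure K (f t)) ->
  f @ Fl --> l.
Proof.
move=> H N lN.
have [W lW WN] := @uniform_regular E l N lN.
have [K [Ko Kc Kl KW]] := convex_nbhs lW.
apply: filterS (H K Ko Kc Kl) => t Kt /=.
by apply: WN; exact: closure_subset Kt.
Qed.

Lemma cvg_convex {T : Type} {Fl : set_system T} {FF : Filter Fl}
    (f : T -> E) (l : E) :
  (forall K : set E, open K -> convex_set K -> K l ->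
    \forall t \near Fl, K (f t)) ->
  f @ Fl --> l.
Proof.
move=> H; apply: cvg_convex_closure => K Ko Kc Kl.
by apply: filterS (H K Ko Kc Kl) => t; exact: subset_closure.
Qed.

(** The homothety with centre [p] and ratio [a] maps [C] into itself, and it is
an open map. *)
Lemma convex_interior_segment (C : set E) (c p : E) (a : R) :
  convex_set C -> C° c -> C p -> 0 < a <= 1 -> C° (p + a *: (c - p)).
Proof.
move=> cC Cc Cp /andP[a0 a1].
have an0 : a != 0 by rewrite gt_eqF.
pose g (y : E) := p + a^-1 *: (y - p).
have gE : g (p + a *: (c - p)) = c.
  by rewrite /g addrAC subrr add0r scalerA mulVf// scale1r addrC subrK.
have key : g y @[y --> p + a *: (c - p)] --> c.
  rewrite -[X in _ --> X]gE; apply: tvs_cvgD; first exact: cvg_cst.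
  apply: tvs_cvgZ; first exact: cvg_cst.
  by apply: tvs_cvgB; [exact: cvg_id|exact: cvg_cst].
apply: (@filterS _ (nbhs (p + a *: (c - p))) _ _ _ _ (key C Cc)) => y /= Cy.
have := convex_setP cC (t := a) _ Cp Cy; rewrite (ltW a0) a1 => /(_ isT).
by rewrite addrAC subrr add0r scalerA mulfV// scale1r addrC subrK.
Qed.

Lemma convex_interior (C : set E) : convex_set C -> convex_set C°.
Proof.
move=> cC; apply: convex_set_of => x y t /andP[t0 t1] Cx Cy.
have [->|tn0] := eqVneq t 0; first by rewrite scale0r addr0.
apply: convex_interior_segment => //; first exact: interior_subset Cx.
by rewrite lt_neqAle eq_sym tn0 t0.
Qed.

Lemma convex_setI (A B : set E) :
  convex_set A -> convex_set B -> convex_set (A `&` B).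
Proof.
move=> cA cB; apply: convex_set_of => x y t t01 [Ax Bx] [Ay By].
by split; exact: convex_setP.
Qed.

End Convexity.

(** * Directional derivatives and the mean value theorem *)

Section MeanValue.
Context {R : realType} {E : tvsType R}.

Lemma convex_slope_cat (K : set E) (F : R -> E) (a b c : R) :
  convex_set K -> a < b -> b < c ->
  K ((b - a)^-1 *: (F b - F a)) -> K ((c - b)^-1 *: (F c - F b)) ->
  K ((c - a)^-1 *: (F c - F a)).
Proof.
move=> cK ab bc Kab Kbc.
have ba0 : b - a != 0 by rewrite subr_eq0 gt_eqF.
have cb0 : c - b != 0 by rewrite subr_eq0 gt_eqF.
have ca0 : c - a != 0 by rewrite subr_eq0 gt_eqF// (lt_trans ab).
have ca : 0 < c - a by lra.
have t01 : 0 <= (c - b) / (c - a) <= 1.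
  apply/andP; split; first by apply: divr_ge0; lra.
  by rewrite ler_pdivrMr// mul1r; lra.
have := convex_setP cK t01 Kab Kbc; congr (K _).
rewrite -(subrKA (F b) (F c) (- F a)); move: (F b - F a) (F c - F b) => u v.
rewrite scalerBr !scalerA scalerDr addrCA -scalerBl.
by congr (_ *: _ + _ *: _); field; rewrite ?ca0 ?ba0 ?cb0.
Qed.

(** The slopes over adjacent intervals combine convexly, so the supremum
of the [t] for which the slope over [0, t] lies in [K] is attained, and it
cannot be smaller than 1. *)
Lemma mean_value_convex (K : set E) (F : R -> E) : convex_set K ->
  (forall t, 0 <= t <= 1 ->
    \forall s \near (0 : R)^', K (s^-1 *: (F (t + s) - F t))) ->
  K (F 1 - F 0).
Proof.
move=> cK HF.
pose P a b := a < b -> K ((b - a)^-1 *: (F b - F a)).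
have Pcat a b c : a <= b -> b <= c -> P a b -> P b c -> P a c.
  rewrite le_eqVlt => /predU1P[->//|ab].
  rewrite le_eqVlt => /predU1P[->//|bc] /(_ ab) Kab /(_ bc) Kbc _.
  exact: convex_slope_cat cK ab bc Kab Kbc.
have near_t t : 0 <= t <= 1 -> exists2 d : R, 0 < d &
    (forall u, t - d < u -> u <= t -> P u t) /\
    (forall u, t <= u -> u < t + d -> P t u).
  move=> /HF; rewrite near_withinE => -[d /= d0 Hd]; exists d => //.
  have Hd' s : `|s| < d -> s != 0 -> K (s^-1 *: (F (t + s) - F t)).
    by move=> sd; apply: Hd; rewrite /= sub0r normrN.
  split=> u h1 h2 h3.
  - have := Hd' (u - t); rewrite subr_eq0 lt_eqF// ltr_norml.
    have -> : (- d < u - t < d) by lra.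
    move=> /(_ isT isT); rewrite [t + _]addrC subrK -opprB invrN scaleNr -scalerN.
    by rewrite opprB.
  - have := Hd' (u - t); rewrite subr_eq0 gt_eqF// ltr_norml.
    have -> : (- d < u - t < d) by lra.
    by move=> /(_ isT isT); rewrite [t + _]addrC subrK.
pose T := [set t | 0 <= t <= 1 /\ P 0 t].
have T0 : T 0 by split; [rewrite lexx ler01|rewrite /P ltxx].
have supT : has_sup T.
  by split; [exists 0|exists 1 => t [/andP[]]].
have tau0 : 0 <= sup T by exact: sup_upper_bound.
have tau1 : sup T <= 1.
  by apply: sup_le_ub; [exists 0|move=> t [/andP[]]].
have [|d d0 [dl dr]] := near_t (sup T); first by rewrite tau0.
have Ptau : P 0 (sup T).
  have [t [/andP[t0 t1] Pt] td] := sup_adherent d0 supT.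
  have tT : t <= sup T by apply: sup_upper_bound => //; split=> //; rewrite t0.
  by apply: (Pcat _ t) => //; apply: dl.
have [tau_lt1|] := ltP (sup T) 1; last first.
  move=> tau_ge1; have tauE : sup T = 1 by apply/eqP; rewrite eq_le tau1.
  by move: Ptau; rewrite tauE => /(_ ltr01); rewrite subr0 invr1 scale1r.
pose u := Num.min 1 (sup T + d / 2).
have uT : sup T < u by rewrite /u lt_min tau_lt1 ltrDl divr_gt0.
have u_ltd : u < sup T + d by rewrite /u gt_min ltrD2l; lra.
have u1 : u <= 1 by rewrite /u ge_min lexx.
have Tu : T u.
  split; first by rewrite u1 (le_trans tau0 (ltW uT)).
  by apply: (Pcat _ (sup T)) => //; [exact: ltW|apply: dr => //; exact: ltW].
by have := sup_upper_bound supT Tu; rewrite leNgt uT.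
Qed.

End MeanValue.

Section DirectionalDerivative.
Context {R : realType} {E F : tvsType R}.
Implicit Types (f g : E -> F) (z h : E) (l : F).

Definition has_ddir f z h l : Prop := dquot f z h t @[t --> 0^'] --> l.

Lemma has_ddir_nbhs f z h l (K : set F) : has_ddir f z h l -> nbhs l K ->
  \forall t \near (0 : R)^', K (dquot f z h t).
Proof. by move=> fl lK; exact: fl. Qed.

Lemma has_ddir_unique f z h l l' : hausdorff_space F ->
  has_ddir f z h l -> has_ddir f z h l' -> l = l'.
Proof. by move=> hF fl fl'; exact: cvg_unique fl fl'. Qed.

Lemma ddirE f z h l : hausdorff_space F -> has_ddir f z h l -> ddir h f z = l.
Proof.
move=> hF fl; rewrite /ddir; case: xgetP => [y -> /= fy|/(_ l)//].
exact: has_ddir_unique hF fy fl.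
Qed.

Lemma ddir_existsP f z h : ddir_exists f z h <-> has_ddir f z h (ddir h f z).
Proof.
split=> [[l fl]|?]; last by exists (ddir h f z).
by rewrite /ddir; case: xgetP => [y -> //|/(_ l)].
Qed.

Lemma has_ddir_near f g z h l : (\forall y \near z, f y = g y) ->
  has_ddir f z h l -> has_ddir g z h l.
Proof.
move=> fg; apply: cvg_trans; apply: near_eq_cvg.
have fgz := nbhs_singleton fg.
apply: filterS (nbhs_line h fg) => t /= fgt.
by rewrite /dquot fgz fgt.
Qed.

Lemma has_ddir_open (O : set E) f g z h l : open O -> O z -> {in O, f =1 g} ->
  has_ddir f z h l -> has_ddir g z h l.
Proof.
move=> oO Oz fg; apply: has_ddir_near.
by apply: filterS (open_nbhs_nbhs (conj oO Oz)) => y Oy; apply: fg; exact/mem_set.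
Qed.

Lemma has_ddirD f g z h l l' : has_ddir f z h l -> has_ddir g z h l' ->
  has_ddir (fun y => f y + g y) z h (l + l').
Proof.
move=> fl gl; apply: cvg_trans (tvs_cvgD fl gl); apply: near_eq_cvg.
by apply: nearW => t; rewrite /dquot -scalerDr opprD addrACA.
Qed.

Lemma has_ddirZ (c : R) f z h l : has_ddir f z h l ->
  has_ddir (fun y => c *: f y) z h (c *: l).
Proof.
move=> fl; apply: cvg_trans (tvs_cvgZ (cvg_cst c) fl); apply: near_eq_cvg.
by apply: nearW => t; rewrite /dquot -scalerBr !scalerA mulrC.
Qed.

Lemma has_ddirN f z h l : has_ddir f z h l ->
  has_ddir (fun y => - f y) z h (- l).
Proof.
move=> fl; apply: cvg_trans (tvs_cvgN fl); apply: near_eq_cvg.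
by apply: nearW => t; rewrite /dquot -scalerN opprB opprK addrC.
Qed.

Lemma has_ddirB f g z h l l' : has_ddir f z h l -> has_ddir g z h l' ->
  has_ddir (fun y => f y - g y) z h (l - l').
Proof. by move=> fl gl; apply: has_ddirD => //; exact: has_ddirN. Qed.

Lemma has_ddir_cst l z h : has_ddir (fun _ => l) z h 0.
Proof.
rewrite /has_ddir /dquot; under eq_fun do rewrite subrr scaler0.
exact: cvg_cst.
Qed.

Lemma has_ddir_sum (I : eqType) (s : seq I) (f : I -> E -> F) z h (l : I -> F) :
  (forall i, i \in s -> has_ddir (f i) z h (l i)) ->
  has_ddir (fun y => \sum_(i <- s) f i y) z h (\sum_(i <- s) l i).
Proof.
elim: s => [|i s IH] H.
  by rewrite big_nil; under eq_fun do rewrite big_nil; exact: has_ddir_cst.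
rewrite big_cons; under eq_fun do rewrite big_cons.
apply: has_ddirD; first by apply: H; rewrite mem_head.
by apply: IH => j js; apply: H; rewrite in_cons js orbT.
Qed.

Lemma has_ddir_shift f z a h l : has_ddir f (z + a) h l ->
  has_ddir (fun y => f (y + a)) z h l.
Proof.
apply: cvg_trans; apply: near_eq_cvg; apply: nearW => t.
by rewrite /dquot addrAC.
Qed.

Lemma has_ddir_dir0 f z : has_ddir f z 0 0.
Proof.
rewrite /has_ddir /dquot; under eq_fun do rewrite scaler0 addr0 subrr scaler0.
exact: cvg_cst.
Qed.

Lemma dnbhs0Z (c : R) : c != 0 -> c * t @[t --> (0 : R)^'] --> (0 : R)^'.
Proof.
move=> c0 A; rewrite /dnbhs/= !withinE => -[V V0 AV].
have V0' : nbhs (c * 0) V by rewrite mulr0.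
exists [set t | V (c * t)].
  by apply: (@mulrl_continuous _ c 0) V0'.
apply/seteqP; split=> t [/= At t0]; split=> //=.
  suff : (V `&` [set x | x != 0]) (c * t) by case.
  by rewrite -AV; split=> //=; rewrite mulf_neq0.
suff : (A `&` [set x | x != 0]) (c * t) by case.
by rewrite AV; split=> //=; rewrite mulf_neq0.
Qed.

Lemma has_ddir_dirZ (c : R) f z h l : has_ddir f z h l ->
  has_ddir f z (c *: h) (c *: l).
Proof.
have [->|c0] := eqVneq c 0; first by rewrite !scale0r => _; exact: has_ddir_dir0.
move=> fl.
have : c *: dquot f z h (c * t) @[t --> (0 : R)^'] --> c *: l.
  by apply: tvs_cvgZ; [exact: cvg_cst|exact: cvg_comp (dnbhs0Z c0) fl].
apply: cvg_trans; apply: near_eq_cvg; near=> t => /=.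
rewrite /dquot !scalerA invfM mulrA mulfV// mul1r.
by rewrite [t * c]mulrC.
Unshelve. all: by end_near. Qed.

(** For open [K] the derivatives of [f] in [K] have nearby difference quotients
in [K], so the mean value theorem needs no closure; this makes it possible to
apply it twice in a row without enlarging [K]. *)
Lemma dquot_in_convex (N : set E) (K : set F) (f A : E -> F) z h (t : R) :
  convex_set N -> open K -> convex_set K ->
  (forall y, N y -> has_ddir f y h (A y)) -> (forall y, N y -> K (A y)) ->
  t != 0 -> N z -> N (z + t *: h) -> K (dquot f z h t).
Proof.
move=> cN oK cK fA KA t0 Nz Nzt; rewrite /dquot scalerBr.
pose c s := t^-1 *: f (z + s *: (t *: h)).
have -> : t^-1 *: f (z + t *: h) = c 1 by rewrite /c scale1r.
have -> : t^-1 *: f z = c 0 by rewrite /c scale0r addr0.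
apply: mean_value_convex => // s s01.
have Ny : N (z + s *: (t *: h)).
  by have := convex_setP cN s01 Nz Nzt; rewrite [z + _ - z]addrAC subrr add0r.
have H := has_ddirZ (c := t^-1) (has_ddir_dirZ (c := t) (fA _ Ny)).
rewrite scalerA mulVf// scale1r in H.
apply: filterS (has_ddir_nbhs H (open_nbhs_nbhs (conj oK (KA _ Ny)))) => u /=.
rewrite /dquot; congr (K (_ *: (_ - _))).
by rewrite /c scalerDl addrA.
Qed.

End DirectionalDerivative.

(** * Schwarz' theorem and the chain rule at boundary points *)

Section Rules.
Context {R : realType}.

Lemma contractionE {E : tvsType R} (x c : E) (e : R) :
  x + e *: (c - x) = (1 - e) *: x + e *: c.
Proof. by rewrite scalerBr scalerBl scale1r addrA addrAC. Qed.

(** Moving first along [h1], then along [h2]: by the mean value theorem, the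
slope of the second move is close to [A z] although it starts at a moving
point. *)
Lemma has_ddir_dirD {E F : tvsType R} (f A : E -> F) (z h1 h2 : E) (l : F) :
  has_ddir f z h1 l -> (\forall y \near z, has_ddir f y h2 (A y)) ->
  A @ z --> A z -> has_ddir f z (h1 + h2) (l + A z).
Proof.
move=> fl fA Az.
have H : dquot f (z + t *: h1) h2 t @[t --> (0 : R)^'] --> A z.
  apply: cvg_convex => K oK cK KAz.
  have KN : nbhs z (A @^-1` K) by apply: Az; exact: (open_nbhs_nbhs (conj oK KAz)).
  have [N [oN cN Nz NS]] := convex_nbhs (filterI fA KN).
  have zN := open_nbhs_nbhs (conj oN Nz).
  near=> t.
  apply: (dquot_in_convex (N := N) (A := A)) => //.
  - by move=> y /NS[].
  - by move=> y /NS[].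
  - by near: t; exact: nbhs_dnbhs_neq.
  - by near: t; exact: nbhs_line.
  - by rewrite -addrA -scalerDr; near: t; exact: nbhs_line.
apply: cvg_trans (tvs_cvgD fl H); apply: near_eq_cvg; apply: nearW => t.
by rewrite /dquot [t *: (h1 + h2)]scalerDr addrA -scalerDr [X in _ *: X = _]addrC subrKA.
Unshelve. all: by end_near. Qed.

(** Schwarz' theorem, where the existence of the other mixed derivative is part
of the conclusion.  The second difference of [phi] is a difference
quotient of [B] up to the mean value theorem, so it is close to [C z]; letting
the step in the direction [w] tend to 0 turns it into a difference quotient of
[A]. *)
Lemma has_ddir_swap {E F : tvsType R} (O : set E) (phi A B C : E -> F)
    (z w q : E) : open O -> O z ->
  (forall y, O y -> has_ddir phi y w (A y)) ->
  (forall y, O y -> has_ddir phi y q (B y)) ->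
  (forall y, O y -> has_ddir B y w (C y)) ->
  C @ z --> C z -> has_ddir A z q (C z).
Proof.
move=> oO Oz phiA phiB BC Cz; apply: cvg_convex_closure => K oK cK KCz.
have KN : nbhs z (C @^-1` K) by apply: Cz; exact: (open_nbhs_nbhs (conj oK KCz)).
have zO := open_nbhs_nbhs (conj oO Oz).
have [N [oN cN Nz NS]] := convex_nbhs (filterI zO KN).
have NO y : N y -> O y by move=> /NS[].
have KC y : N y -> K (C y) by move=> /NS[].
have nbhs_N y : N y -> nbhs y N by move=> ?; exact: open_nbhs_nbhs.
near=> t.
have t0 : t != 0 by near: t; exact: nbhs_dnbhs_neq.
have Nt : N (z + t *: q) by near: t; exact: (nbhs_line _ (nbhs_N _ Nz)).
pose psi y := t^-1 *: (phi (y + t *: q) - phi y).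
(* The limit of the second difference as the step along [w] tends to 0. *)
have psiA : has_ddir psi z w (dquot A z q t).
  apply: has_ddirZ; apply: has_ddirB; last exact: phiA.
  by apply: has_ddir_shift; apply: phiA; exact: NO.
apply: (closure_lim psiA); near=> s.
have s0 : s != 0 by near: s; exact: nbhs_dnbhs_neq.
have Ns : N (z + s *: w) by near: s; exact: (nbhs_line _ (nbhs_N _ Nz)).
have Nts : N (z + t *: q + s *: w) by near: s; exact: (nbhs_line _ (nbhs_N _ Nt)).
(* The points whose translates along [w] stay in [N], again a convex set, on
which the mean value theorem is applied along [q]. *)
pose Ms := [set y | N y /\ N (y + s *: w)].
have cMs : convex_set Ms.
  apply: convex_set_of => x y u u01 [Nx Nxs] [Ny Nys]; split.
    exact: convex_setP.
  have := convex_setP cN u01 Nxs Nys.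
  by rewrite opprD addrACA subrr addr0 addrAC.
have -> : dquot psi z w s =
    dquot (fun y => s^-1 *: (phi (y + s *: w) - phi y)) z q t.
  rewrite /dquot /psi -!scalerBr !scalerA [s^-1 * _]mulrC; congr (_ *: _).
  by rewrite [z + s *: w + _]addrAC !opprB addrACA [RHS]addrACA; congr (_ + _);
    rewrite addrC.
apply: (dquot_in_convex (N := Ms) (A := fun y => dquot B y w s)) => //.
- move=> y [Ny Nys]; apply: has_ddirZ; apply: has_ddirB; last by apply: phiB; exact: NO.
  by apply: has_ddir_shift; apply: phiB; exact: NO.
- move=> y [Ny Nys].
  apply: (dquot_in_convex (N := N) (A := C)) => //.
  by move=> ? ?; apply: BC; exact: NO.
Unshelve. all: by end_near. Qed.

(** The chain rule along a curve [gam] that may run through boundary points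
of [D], where [G] is only known to be continuous.  Contracting [gam 0] and
[gam t] towards an interior point [c0] of a convex neighbourhood moves the
segment between them into the interior, where the mean value theorem applies;
then the contraction tends to the identity.  The set [S] of admissible
directions makes it possible to differentiate in fewer variables than [G]
has. *)
Lemma chain_rule_boundary {Z F : tvsType R} (D S : set Z) (G : Z -> F)
    (dG : Z -> Z -> F) (gam : R -> Z) (h : Z) :
  locally_convex_subset D -> dense_interior D ->
  (forall (c : R) y, S y -> S (c *: y)) ->
  (forall y, D y -> G @ within D (nbhs y) --> G y) ->
  (forall y k, D° y -> S k -> has_ddir G y k (dG y k)) ->
  (fun yk => dG yk.1 yk.2) @ within (D `*` S) (nbhs (gam 0, h))
    --> dG (gam 0) h ->
  D (gam 0) -> (\forall t \near (0 : R)^', D (gam t) /\ S (gam t - gam 0)) ->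
  t^-1 *: (gam t - gam 0) @[t --> (0 : R)^'] --> h ->
  t^-1 *: (G (gam t) - G (gam 0)) @[t --> (0 : R)^'] --> dG (gam 0) h.
Proof.
move=> lcD diD SZ Gc GD dGc D0 gamD gamh.
apply: cvg_convex_closure => K oK cK Kh.
have [C [cC CD C0]] := lcD _ D0.
have [[N1 M] /= [N1n Mn] KNM] := dGc K (open_nbhs_nbhs (conj oK Kh)).
have [N [oN cN N0 NS]] := convex_nbhs (filterI N1n C0).
have NC y : N y -> D y -> C y by move=> /NS[].
have KN y k : N y -> D y -> M k -> S k -> K (dG y k).
  by move=> /NS[N1y _] Dy Mk Sk; apply: (KNM (y, k)).
(* [N] meets the interior of [D] in points that are interior to [C]. *)
have [c0 [Dc0 Nc0]] := diD _ D0 N (open_nbhs_nbhs (conj oN N0)).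
have Cc0 : C° c0.
  have : nbhs c0 (N `&` D) by apply: filterI => //; exact: open_nbhs_nbhs.
  by apply: filterS => y [Ny Dy]; exact: NC.
have gam0 := cvg_of_quotient gamh.
near=> t.
have t0 : t != 0 by near: t; exact: nbhs_dnbhs_neq.
have [Dt St] : D (gam t) /\ S (gam t - gam 0) by near: t.
have Nt : N (gam t).
  by near: t; exact: (gam0 _ (open_nbhs_nbhs (conj oN N0))).
have Mt : M° (t^-1 *: (gam t - gam 0)).
  by near: t; exact: (gamh _ (nbhs_interior Mn)).
have contr (p : Z) : D p -> N p ->
    [/\ p + e *: (c0 - p) @[e --> (0 : R)^'+] --> p,
        \forall e \near (0 : R)^'+, N (p + e *: (c0 - p)),
        \forall e \near (0 : R)^'+, C° (p + e *: (c0 - p)) &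
        G (p + e *: (c0 - p)) @[e --> (0 : R)^'+] --> G p].
  move=> Dp Np.
  have H : p + e *: (c0 - p) @[e --> (0 : R)^'+] --> p.
    rewrite -[X in _ --> X]addr0 -(scale0r (c0 - p)).
    apply: tvs_cvgD; first exact: cvg_cst.
    by apply: tvs_cvgZ; [exact: cvg_within_filter|exact: cvg_cst].
  have HC : \forall e \near (0 : R)^'+, C° (p + e *: (c0 - p)).
    near=> e; apply: convex_interior_segment => //; first exact: NC.
    by apply/andP; split; near: e; [exact: nbhs_right_gt|exact: nbhs_right_le].
  split=> //; first exact: (H _ (open_nbhs_nbhs (conj oN Np))).
  apply: cvg_trans (Gc p Dp); move=> A; rewrite /= !nbhs_simpl /= => HA.
  rewrite /within /= in HA.
  have := H _ HA; rewrite nbhs_simpl /= => HA'.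
  near=> e.
  have : D (p + e *: (c0 - p)) -> A (G (p + e *: (c0 - p))) by near: e.
  apply; apply: CD; apply: interior_subset; by near: e.
have [p0 pN pC pG] := contr _ D0 N0.
have [q0 qN qC qG] := contr _ Dt Nt.
have lim : t^-1 *: (G (gam t + e *: (c0 - gam t)) -
    G (gam 0 + e *: (c0 - gam 0))) @[e --> (0 : R)^'+] -->
    t^-1 *: (G (gam t) - G (gam 0)).
  by apply: tvs_cvgZ; [exact: cvg_cst|exact: tvs_cvgB].
apply: (closure_lim lim).
have hM : (1 - e) *: (t^-1 *: (gam t - gam 0)) @[e --> (0 : R)^'+] -->
    t^-1 *: (gam t - gam 0).
  rewrite -[X in _ --> X]scale1r -[X in _ --> X *: _](subr0 (1 : R)).
  apply: tvs_cvgZ; last exact: cvg_cst.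
  apply: cvgB; first exact: cvg_cst.
  exact: cvg_within_filter.
near=> e.
have Mk : M ((1 - e) *: (t^-1 *: (gam t - gam 0))).
  by near: e; exact: hM.
set k := _ *: _ in Mk.
have Sk : S k by apply: (SZ); apply: (SZ).
set p := gam 0 + _.
(* The contracted points differ by [t] times the contracted quotient. *)
have qE : gam t + e *: (c0 - gam t) = p + t *: k.
  rewrite /p /k !scalerA mulrAC mulfV// mul1r !contractionE scalerBr.
  by rewrite [RHS]addrC addrA subrK.
rewrite qE -/(dquot G p k t).
apply: (dquot_in_convex (N := N `&` C°) (A := dG^~ k)) => //.
- by apply: convex_setI => //; exact: convex_interior.
- move=> y [Ny Cy]; apply: GD => //.
  exact: filterS CD Cy.
- move=> y [Ny Cy]; apply: KN => //; apply: CD; exact: interior_subset.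
- rewrite /p; clear p qE; clear k Mk Sk; by split; near: e.
- rewrite -qE; clear p qE; clear k Mk Sk; by split; near: e.
Unshelve. all: by end_near. Qed.

End Rules.

(** * Iterated directional derivatives *)

Section FiniteTuples.
Context {R : realType} {E : tvsType R}.

(** Lists of directions replace the tuples of [tpow], so that appending a
direction does not change the type. *)
Definition tpow_of (n : nat) (s : seq E) : tpow E n := fun l => nth 0 s l.

Lemma cvg_tpow {T : Type} {Fl : set_system T} {FF : Filter Fl} (n : nat)
    (g : T -> tpow E n) (a : tpow E n) :
  (forall l, g t l @[t --> Fl] --> a l) -> g @ Fl --> a.
Proof.
move=> ga; apply/cvg_sup => i; apply/cvg_image.
  apply/seteqP; split=> // x _; exists (fun=> x) => //.
move=> A aA; exists (@^~ i @^-1` A); first exact: (ga i).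
apply/seteqP; split=> [x [y Ay <-//]|x Ax]; exists (fun=> x) => //.
Qed.

Lemma cvg_nth_rcons {T : Type} {Fl : set_system T}
    {FF : Filter Fl} (ws : seq E) (x : T -> E) (x0 : E) k :
  x @ Fl --> x0 -> nth 0 (rcons ws (x t)) k @[t --> Fl] --> nth 0 (rcons ws x0) k.
Proof.
move=> xx0; rewrite nth_rcons; under eq_fun do rewrite nth_rcons.
by case: ifP => _; [exact: cvg_cst|case: ifP => _ //; exact: cvg_cst].
Qed.

Lemma cvg_nth_map {T : Type} {L : eqType} {Fl : set_system T}
    {FF : Filter Fl} (a : T -> L -> E) (a0 : L -> E) (A : seq L) i :
  (forall l, l \in A -> a t l @[t --> Fl] --> a0 l) ->
  nth 0 (map (a t) A) i @[t --> Fl] --> nth 0 (map a0 A) i.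
Proof.
elim: A i => [|l A IH] [|i] H /=; try exact: cvg_cst.
  by apply: H; rewrite mem_head.
by apply: IH => j jA; apply: H; rewrite in_cons jA orbT.
Qed.

Lemma map_nth_enum_ord (s : seq E) :
  [seq nth 0 s (val l) | l <- enum 'I_(size s)] = s.
Proof.
rewrite (map_comp (nth 0 s) val) val_enum_ord map_nth_iota0//.
by rewrite take_size.
Qed.

End FiniteTuples.
Arguments tpow_of {R E} n s.

Definition fst_dirs {R : realType} {E1 E2 : tvsType R} (ws : seq E1)
  : seq (E1 * E2) := [seq (w, 0) | w <- ws].
Definition snd_dirs {R : realType} {E1 E2 : tvsType R} (vs : seq E2)
  : seq (E1 * E2) := [seq (0, v) | v <- vs].

Lemma dirs_tpow_of {R : realType} {E1 E2 : tvsType R} (ws : seq E1)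
    (vs : seq E2) :
  dirs (tpow_of (size ws) ws) (tpow_of (size vs) vs) = snd_dirs vs ++ fst_dirs ws.
Proof.
rewrite /dirs /snd_dirs /fst_dirs -[in RHS](map_nth_enum_ord ws).
by rewrite -[in RHS](map_nth_enum_ord vs) -!map_comp.
Qed.

Section Iterated.
Context {R : realType} {E F : tvsType R} (hF : hausdorff_space F).
Implicit Types (O : set E) (f g : E -> F) (hs : seq E).

Lemma ddirs_cat hs hs' f : ddirs (hs ++ hs') f = ddirs hs' (ddirs hs f).
Proof. by elim: hs f => //= h hs IH f; rewrite IH. Qed.

Lemma ddirs_exist_cat O hs hs' f : ddirs_exist O (hs ++ hs') f <->
  ddirs_exist O hs f /\ ddirs_exist O hs' (ddirs hs f).
Proof.
elim: hs f => [|h hs IH] f /=; first by split=> [|[]].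
by rewrite IH; split=> [[? []]|[[? ?]]].
Qed.

Lemma eq_ddir O f g h : open O -> {in O, f =1 g} ->
  {in O, forall z, ddir_exists f z h} -> {in O, ddir h f =1 ddir h g}.
Proof.
move=> oO fg fe z zO; apply/esym/ddirE => //.
apply: (has_ddir_open oO (set_mem zO) fg).
by apply/ddir_existsP; exact: fe.
Qed.

Lemma eq_ddirs O f g hs : open O -> {in O, f =1 g} -> ddirs_exist O hs f ->
  ddirs_exist O hs g /\ {in O, ddirs hs f =1 ddirs hs g}.
Proof.
move=> oO; elim: hs f g => //= h hs IH f g fg [fe fse].
have fe' : {in O, forall z, ddir_exists f z h} by move=> z /set_mem; exact: fe.
have [H1 H2] := IH _ _ (eq_ddir oO fg fe') fse.
split=> //; split=> // z Oz; exists (ddir h f z).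
by apply: (has_ddir_open oO Oz fg); apply/ddir_existsP; exact: fe.
Qed.

Lemma ddirs_lin O (c : R) f g hs : open O -> ddirs_exist O hs f ->
  ddirs_exist O hs g ->
  let fg := fun y => f y + c *: g y in
  ddirs_exist O hs fg /\
  {in O, ddirs hs fg =1 fun y => ddirs hs f y + c *: ddirs hs g y}.
Proof.
move=> oO; elim: hs f g => //= h hs IH f g [fe fse] [ge gse].
have H z : O z -> has_ddir (fun y => f y + c *: g y) z h
    (ddir h f z + c *: ddir h g z).
  move=> Oz; apply: has_ddirD; first by apply/ddir_existsP; exact: fe.
  by apply: has_ddirZ; apply/ddir_existsP; exact: ge.
have [H1 H2] := IH _ _ fse gse.
have fgE : {in O, (fun y => ddir h f y + c *: ddir h g y) =1
    ddir h (fun y => f y + c *: g y)}.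
  by move=> z /set_mem Oz; apply/esym/ddirE => //; exact: H.
have [H3 H4] := eq_ddirs oO fgE H1.
split; first by split=> // z Oz; exists (ddir h f z + c *: ddir h g z); exact: H.
by move=> z zO; rewrite -H4// H2.
Qed.

(** A direction [q] moves past a whole list of directions by repeated use of
Schwarz' theorem. *)
Lemma has_ddir_ddirs_swap O f hs q : open O ->
  (forall z, O z -> ddir_exists f z q) ->
  ddirs_exist O hs f -> ddirs_exist O hs (ddir q f) ->
  (forall n z, O z -> ddirs (take n hs) (ddir q f) @ z -->
     ddirs (take n hs) (ddir q f) z) ->
  forall z, O z -> has_ddir (ddirs hs f) z q (ddirs hs (ddir q f) z).
Proof.
move=> oO; elim: hs f => [|h hs IH] f fq /=.
  by move=> _ _ _ z Oz; apply/ddir_existsP; exact: fq.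
move=> [fh fhs] [fqh fqhs] cont.
have swap z : O z -> has_ddir (ddir h f) z q (ddir h (ddir q f) z).
  move=> Oz; apply: (@has_ddir_swap _ _ _ O f _ (ddir q f)
    (ddir h (ddir q f)) z h q oO Oz).
  - by move=> y Oy; apply/ddir_existsP; exact: fh.
  - by move=> y Oy; apply/ddir_existsP; exact: fq.
  - by move=> y Oy; apply/ddir_existsP; exact: fqh.
  - by have := cont 1%N z Oz; rewrite /= take0.
have swapE : {in O, ddir h (ddir q f) =1 ddir q (ddir h f)}.
  by move=> z /set_mem Oz; apply/esym/ddirE => //; exact: swap.
have [fqhs' fqhsE] := eq_ddirs oO swapE fqhs.
move=> z Oz; rewrite fqhsE; last exact/mem_set.
apply: IH => // [y Oy|n y Oy].
  by exists (ddir h (ddir q f) y); exact: swap.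
have pre : ddirs_exist O (take n hs) (ddir h (ddir q f)).
  by move: fqhs; rewrite -{1}(cat_take_drop n hs) ddirs_exist_cat => -[].
have [_ preE] := eq_ddirs oO swapE pre.
have := cont n.+1 y Oy; rewrite /= (preE y (mem_set Oy)); apply: cvg_trans.
apply: near_eq_cvg; apply: filterS (open_nbhs_nbhs (conj oO Oy)) => x Ox.
exact: (preE x (mem_set Ox)).
Qed.

End Iterated.

(** * The derivatives of a map of class C^{r,s} *)

Local Notation "n <=e r" := (enat_le (ENat n) r) (at level 70).

Lemma enat_leW (m n : nat) (r : enat) : (m <= n)%N -> n <=e r -> m <=e r.
Proof. by case: r => //= k; exact: leq_trans. Qed.

Lemma enat_le0 (r : enat) : 0 <=e r.
Proof. by case: r. Qed.

Lemma interior_setX {T1 T2 : topologicalType} (A : set T1) (B : set T2) :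
  (A `*` B)° = A° `*` B°.
Proof.
apply/seteqP; split=> [[x y] [[M N] /= [xM yN] MNAB]|[x y] /= [Ax By]].
  by split; [apply: filterS xM => u Mu|apply: filterS yN => u Nu];
    [have [] := MNAB (u, y) (conj Mu (nbhs_singleton yN))
    |have [] := MNAB (x, u) (conj (nbhs_singleton xM) Nu)].
by exists (A, B).
Qed.

Section Jet.
Context {R : realType} {E1 E2 F : tvsType R}.

Lemma dense_interior_setX (A : set E1) (B : set E2) :
  dense_interior A -> dense_interior B -> dense_interior (A `*` B).
Proof.
move=> dA dB [x y] [/= /dA Ax /dB By] W [[M N] /= [xM yN] MNW].
rewrite interior_setX; have [a [Aa Ma]] := Ax M xM; have [b [Bb Nb]] := By N yN.
by exists (a, b); split => //; exact: MNW.
Qed.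

Lemma locally_convex_setX (A : set E1) (B : set E2) :
  locally_convex_subset A -> locally_convex_subset B ->
  locally_convex_subset (A `*` B).
Proof.
move=> lA lB [x y] [/= /lA[C [cC CA Cx]] /lB[C' [cC' CB Cy]]].
exists (C `*` C'); split.
- apply: convex_set_of => -[a b] [a' b'] t t01 /= [Ca Cb] [Ca' Cb'].
  by split; apply: convex_setP.
- by move=> [a b] [/= /CA ? /CB ?].
- exists ([set u | A u -> C u], [set v | B v -> C' v]) => //=.
  by move=> [a b] [/= ha hb] [/= Aa Bb]; split; [exact: ha|exact: hb].
Qed.

(** A choice of the continuous extensions of all the derivatives of [f], as one
function [D] of lists of directions and a point.  Continuity is stated for
lists of constant lengths along an arbitrary filter: this covers both limits
in the base point and limits in the directions. *)
Record is_jet (r s : enat) (U : set E1) (V : set E2) (f : E1 * E2 -> F)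
    (D : seq E1 -> seq E2 -> E1 * E2 -> F) : Prop := IsJet {
  jet_cvg : forall (T : Type) (Fl : set_system T) (FF : Filter Fl)
      (ws : T -> seq E1) (vs : T -> seq E2) (z : T -> E1 * E2) ws0 vs0 z0,
    size ws0 <=e r -> size vs0 <=e s -> (U `*` V) z0 ->
    (\forall t \near Fl, (U `*` V) (z t)) ->
    (forall t, size (ws t) = size ws0) -> (forall t, size (vs t) = size vs0) ->
    z @ Fl --> z0 ->
    (forall k, nth 0 (ws t) k @[t --> Fl] --> nth 0 ws0 k) ->
    (forall k, nth 0 (vs t) k @[t --> Fl] --> nth 0 vs0 k) ->
    D (ws t) (vs t) (z t) @[t --> Fl] --> D ws0 vs0 z0;
  jet_nil : forall z, (U `*` V) z -> D [::] [::] z = f z;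
  jet_ddirs : forall ws vs z, size ws <=e r -> size vs <=e s ->
    (U° `*` V°) z -> D ws vs z = ddirs (snd_dirs vs ++ fst_dirs ws) f z;
  jet_exist : forall ws vs, size ws <=e r -> size vs <=e s ->
    ddirs_exist (U° `*` V°) (snd_dirs vs ++ fst_dirs ws) f }.

Lemma Crs_jet r s U V f : Crs r s U V f -> exists D, is_jet r s U V f D.
Proof.
move=> [fo fext].
have dd i j : {d : E1 * E2 * tpow E1 i * tpow E2 j -> F | i <=e r -> j <=e s ->
    [/\ {within dij_dom U V, continuous d},
        {in dij_dom U° V°, d =1 dij f} &
        (i = 0)%N -> (j = 0)%N -> {in dij_dom U V, forall q, d q = f q.1.1}]}.
  apply: cid; have [ir|ir] := boolP (i <=e r); last by exists (fun=> 0).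
  have [js|js] := boolP (j <=e s); last by exists (fun=> 0).
  by have [d dP] := fext i j ir js; exists d.
pose ddv i j := sval (dd i j).
pose D (ws : seq E1) (vs : seq E2) z :=
  ddv (size ws) (size vs) (z, tpow_of (size ws) ws, tpow_of (size vs) vs).
have DE ws vs z i j : size ws = i -> size vs = j ->
  D ws vs z = ddv i j (z, tpow_of i ws, tpow_of j vs) by move=> <- <-.
have domP i j W1 W2 z w v : (W1 `*` W2) z -> @dij_dom R E1 E2 i j W1 W2 (z, w, v).
  by move=> Wz; split.
exists D; split.
- move=> T Fl FF ws vs z ws0 vs0 z0 wr vs_ Uz0 Uz sw sv zz0 ww0 vv0.
  have [dc _ _] := svalP (dd (size ws0) (size vs0)) wr vs_.
  under eq_fun do rewrite (DE _ _ _ _ _ (sw _) (sv _)).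
  have /subspace_continuousP/(_ (z0, tpow_of (size ws0) ws0,
    tpow_of (size vs0) vs0) (domP _ _ _ _ _ _ _ Uz0)) := dc.
  apply: (@cvg_comp _ _ _ (fun t => (z t, tpow_of (size ws0) (ws t),
    tpow_of (size vs0) (vs t)))); apply: cvg_to_within.
    by apply: filterS Uz => t; exact: domP.
  apply: cvg_pair_nbhs; last by apply: cvg_tpow => l; exact: vv0.
  by apply: cvg_pair_nbhs => //; apply: cvg_tpow => l; exact: ww0.
- move=> z Uz; have [_ _ d0] := svalP (dd 0 0)%N (enat_le0 r) (enat_le0 s).
  by rewrite /D /ddv d0//; apply/mem_set; exact: domP.
- move=> ws vs z wr vs_ Uz.
  have [_ dE _] := svalP (dd (size ws) (size vs)) wr vs_.
  by rewrite /D /ddv dE/= ?/dij/= ?dirs_tpow_of//; apply/mem_set; exact: domP.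
- move=> ws vs wr vs_; have [+ _] := fo _ _ wr vs_.
  by move=> /(_ (tpow_of _ ws) (tpow_of _ vs)); rewrite dirs_tpow_of.
Qed.

Section JetTheory.
Variables (hF : hausdorff_space F) (r s : enat) (U : set E1) (V : set E2).
Variables (f : E1 * E2 -> F) (D : seq E1 -> seq E2 -> E1 * E2 -> F).
Hypothesis jD : is_jet r s U V f D.

Let O := U° `*` V°.

Let oO : open O.
Proof. by rewrite /O -interior_setX; exact: open_interior. Qed.

Let OUV : O `<=` U `*` V.
Proof. by rewrite /O -interior_setX; exact: interior_subset. Qed.

Lemma jet_within ws vs z : size ws <=e r -> size vs <=e s -> (U `*` V) z ->
  D ws vs @ within (U `*` V) (nbhs z) --> D ws vs z.
Proof.
move=> wr vs_ Uz; apply: (jet_cvg jD) => //; try by move=> k; exact: cvg_cst.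
- by rewrite near_withinE; exact: nearW.
- exact: cvg_within.
Qed.

Lemma jet_continuous ws vs z : size ws <=e r -> size vs <=e s -> O z ->
  D ws vs @ z --> D ws vs z.
Proof.
move=> wr vs_ Oz; have := jet_within wr vs_ (OUV Oz).
by rewrite within_interior// interior_setX.
Qed.

Lemma jet_ddir_fst ws w vs z : (size ws).+1 <=e r -> size vs <=e s -> O z ->
  has_ddir (D ws vs) z (w, 0) (D (rcons ws w) vs z).
Proof.
move=> wr vs_ Oz; have wr0 : size ws <=e r by apply: enat_leW wr.
have dirs_rcons : snd_dirs vs ++ fst_dirs (rcons ws w) =
    (snd_dirs vs ++ fst_dirs ws) ++ [:: (w, 0)] :> seq (E1 * E2).
  by rewrite /fst_dirs map_rcons -cats1 catA.
have := jet_exist jD (ws := rcons ws w); rewrite size_rcons => /(_ vs wr vs_).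
rewrite dirs_rcons ddirs_exist_cat /= => -[_ [/(_ z Oz)/ddir_existsP H _]].
rewrite (jet_ddirs jD) ?size_rcons// dirs_rcons ddirs_cat /=.
apply: (has_ddir_open oO Oz) H => y /set_mem Oy.
by rewrite (jet_ddirs jD).
Qed.

(** By definition a further derivative in the first variable comes last, but a
further derivative in the second variable has to move past the directions
[ws]. *)
Lemma jet_ddir_snd ws vs v z : size ws <=e r -> (size vs).+1 <=e s -> O z ->
  has_ddir (D ws vs) z (0, v) (D ws (rcons vs v) z).
Proof.
move=> wr vs_ Oz; have vs0 : size vs <=e s by apply: enat_leW vs_.
have snd_rcons : snd_dirs (rcons vs v) = rcons (snd_dirs vs) (0, v) :> seq (E1 * E2).
  by rewrite /snd_dirs map_rcons.
have := jet_exist jD wr vs0; rewrite ddirs_exist_cat => -[_ ex1].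
have := jet_exist jD (vs := rcons vs v) wr; rewrite size_rcons => /(_ vs_).
rewrite snd_rcons cat_rcons ddirs_exist_cat /= => -[_ [ex2 ex3]].
have DE n y : O y -> ddirs (take n (fst_dirs ws)) (ddir (0, v)
    (ddirs (snd_dirs vs) f)) y = D (take n ws) (rcons vs v) y.
  have sz : size (take n ws) <=e r.
    by apply: enat_leW wr; rewrite size_take; case: ltnP => // /ltnW.
  move=> Oy; rewrite (jet_ddirs jD) ?size_rcons// snd_rcons cat_rcons ddirs_cat.
  by rewrite /= /fst_dirs map_take.
have cont n y : O y -> ddirs (take n (fst_dirs ws)) (ddir (0, v)
    (ddirs (snd_dirs vs) f)) @ y --> ddirs (take n (fst_dirs ws)) (ddir (0, v)
    (ddirs (snd_dirs vs) f)) y.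
  move=> Oy; rewrite DE//.
  have : D (take n ws) (rcons vs v) @ y --> D (take n ws) (rcons vs v) y.
    apply: jet_continuous => //; last by rewrite size_rcons.
    by apply: enat_leW wr; rewrite size_take; case: ltnP => // /ltnW.
  apply: cvg_trans; apply: near_eq_cvg.
  by apply: filterS (open_nbhs_nbhs (conj oO Oy)) => x Ox; rewrite DE.
have := has_ddir_ddirs_swap hF oO ex2 ex1 ex3 cont Oz.
have := DE (size ws) z Oz; rewrite take_size.
rewrite -{1}(size_map (fun w => (w, 0 : E2)) ws) take_size => ->.
apply: (has_ddir_open oO Oz) => y /set_mem Oy.
by rewrite (jet_ddirs jD)// ddirs_cat.
Qed.

Lemma cvg_dense_unique (g g' : E1 * E2 -> F) (A : set (E1 * E2)) z :
  closure A z -> {in A, g =1 g'} -> g @ within A (nbhs z) --> g z ->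
  g' @ within A (nbhs z) --> g' z -> g z = g' z.
Proof.
move=> Az gg' gz g'z; have PF := within_nbhs_proper Az.
apply: (cvg_unique hF gz); apply: cvg_trans g'z; apply: near_eq_cvg.
by rewrite near_withinE; apply: nearW => y Ay; rewrite gg'//; exact/mem_set.
Qed.

(** Linearity of the derivatives in each direction of the second variable
holds in the interior, hence by density wherever the extension is defined. *)
Lemma jet_lin ws vs1 vs2 (c : R) a b z : dense_interior U -> dense_interior V ->
  size ws <=e r -> (size vs1 + size vs2).+1 <=e s -> (U `*` V) z ->
  D ws (vs1 ++ (a + c *: b) :: vs2) z =
    D ws (vs1 ++ a :: vs2) z + c *: D ws (vs1 ++ b :: vs2) z.
Proof.
move=> dU dV wr vs_ Uz.
have sz e : size (vs1 ++ e :: vs2) <=e s.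
  by rewrite size_cat /= addnS.
apply: (@cvg_dense_unique _ (fun z => D ws (vs1 ++ a :: vs2) z +
    c *: D ws (vs1 ++ b :: vs2) z) O).
- by have := dense_interior_setX dU dV Uz; rewrite interior_setX.
- move=> y /set_mem Oy /=.
  pose phi := ddirs (snd_dirs vs1) f.
  have ex e : ddirs_exist O ((0, e) :: snd_dirs vs2 ++ fst_dirs ws) phi.
    have := jet_exist jD wr (sz e); rewrite /snd_dirs map_cat -catA.
    by rewrite ddirs_exist_cat => -[].
  have DE e x : O x -> D ws (vs1 ++ e :: vs2) x =
      ddirs (snd_dirs vs2 ++ fst_dirs ws) (ddir (0, e) phi) x.
    move=> Ox; rewrite (jet_ddirs jD)// /snd_dirs map_cat -catA.
    by rewrite ddirs_cat.
  have linE : {in O, (fun x => ddir (0, a) phi x + c *: ddir (0, b) phi x) =1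
      ddir (0, a + c *: b) phi}.
    move=> x /set_mem Ox; apply/esym/ddirE => //.
    have -> : (0, a + c *: b) = (0, a) + c *: (0, b) :> E1 * E2.
      transitivity (0 + c *: 0 : E1, a + c *: b); last by [].
      by rewrite scaler0 addr0.
    have [[fa _] [fb _]] := (ex a, ex b).
    have fbx x' : O x' -> has_ddir phi x' (0, b) (ddir (0, b) phi x').
      by move=> /fb /ddir_existsP.
    apply: (@has_ddir_dirD _ _ _ phi (fun x => c *: ddir (0, b) phi x)).
    + by apply/ddir_existsP; exact: fa.
    + apply: filterS (open_nbhs_nbhs (conj oO Ox)) => x' /fbx H.
      exact: has_ddir_dirZ.
    + apply: tvs_cvgZ; first exact: cvg_cst.
      have s1 : size (rcons vs1 b) <=e s.
        by rewrite size_rcons; apply: enat_leW vs_; rewrite ltnS leq_addr.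
      have HE x' : O x' -> D [::] (rcons vs1 b) x' = ddir (0, b) phi x'.
        move=> Ox'; rewrite (jet_ddirs jD) ?enat_le0// cats0 /snd_dirs map_rcons.
        by rewrite -cats1 ddirs_cat.
      have := jet_continuous (ws := [::]) (enat_le0 r) s1 Ox; rewrite HE//.
      apply: cvg_trans; apply: near_eq_cvg.
      by apply: filterS (open_nbhs_nbhs (conj oO Ox)) => x' Ox'; rewrite HE.
  have [[_ fa] [_ fb]] := (ex a, ex b).
  have [H1 H2] := ddirs_lin hF c oO fa fb.
  have [_ H3] := eq_ddirs hF oO linE H1.
  rewrite !DE// -H3; last exact/mem_set.
  by rewrite H2//; exact/mem_set.
- have lim e : D ws (vs1 ++ e :: vs2) @ within O (nbhs z) -->
      D ws (vs1 ++ e :: vs2) z.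
    apply: cvg_trans (jet_within wr (sz e) Uz); apply: cvg_app.
    exact: within_subset.
  by [].
- have lim e : D ws (vs1 ++ e :: vs2) @ within O (nbhs z) -->
      D ws (vs1 ++ e :: vs2) z.
    apply: cvg_trans (jet_within wr (sz e) Uz); apply: cvg_app.
    exact: within_subset.
  by apply: tvs_cvgD => //; apply: tvs_cvgZ => //; exact: cvg_cst.
Qed.

End JetTheory.
End Jet.

(** * The chain rule for one derivative of the outer map *)

Section JetChain.
Context {R : realType} {E1 E2 F : tvsType R}.
Variables (hF : hausdorff_space F) (r s : enat) (U : set E1) (V : set E2).
Variables (f : E1 * E2 -> F) (D : seq E1 -> seq E2 -> E1 * E2 -> F).
Hypothesis jD : is_jet r s U V f D.
Hypotheses (lcU : locally_convex_subset U) (dU : dense_interior U).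
Hypotheses (lcV : locally_convex_subset V) (dV : dense_interior V).

(** The Boolean [b] tells whether the first component of the curve moves.  If it
stays constant, no further derivative in the first variable has to exist,
which matters when [size ws] already equals [r]. *)
Lemma jet_chain (b : bool) ws vs (gam : R -> E1 * E2) (h : E1 * E2) :
  size ws <=e r -> (b -> (size ws).+1 <=e r) -> (size vs).+1 <=e s ->
  (U `*` V) (gam 0) -> (\forall t \near (0 : R)^', (U `*` V) (gam t)) ->
  (~~ b -> forall t, (gam t).1 = (gam 0).1) ->
  t^-1 *: (gam t - gam 0) @[t --> (0 : R)^'] --> h ->
  t^-1 *: (D ws vs (gam t) - D ws vs (gam 0)) @[t --> (0 : R)^'] -->
    (if b then D (rcons ws h.1) vs (gam 0) else 0) +
    D ws (rcons vs h.2) (gam 0).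
Proof.
move=> wr wbr vs_ D0 gamD gamb gamh.
have vs0 : size vs <=e s by apply: enat_leW vs_.
pose S := [set y : E1 * E2 | ~~ b -> y.1 = 0].
apply: (@chain_rule_boundary _ _ _ (U `*` V) S (D ws vs) (fun y k =>
  (if b then D (rcons ws k.1) vs y else 0) + D ws (rcons vs k.2) y)) => //.
- exact: locally_convex_setX.
- exact: dense_interior_setX.
- by move=> c y Sy nb; rewrite /= (Sy nb) scaler0.
- by move=> y Dy; exact: (jet_within jD).
- move=> y k; rewrite interior_setX => Oy Sk.
  have := Sk; rewrite /S /=.
  case: (b) wbr => [/(_ isT) wbr _|_ /(_ isT) k0]; last first.
    rewrite add0r [k]surjective_pairing k0; exact: (jet_ddir_snd hF jD).
  (* Split the direction into its two components. *)
  rewrite addrC; have {1}-> : k = (0, k.2) + (k.1, 0).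
    transitivity (0 + k.1, k.2 + 0); last by [].
    by rewrite add0r addr0 -surjective_pairing.
  apply: (@has_ddir_dirD _ _ _ _ (D (rcons ws k.1) vs)).
  + exact: (jet_ddir_snd hF jD).
  + have Oo : open (U° `*` V°) by rewrite -interior_setX; exact: open_interior.
    apply: filterS (open_nbhs_nbhs (conj Oo Oy)) => x Ox.
    exact: (jet_ddir_fst jD).
  + by apply: (jet_continuous jD) => //; rewrite size_rcons.
- set W := within _ _.
  have c1 : (fun yk : (E1 * E2) * (E1 * E2) => yk.1) @ W --> gam 0.
    by apply: cvg_within_filter; exact: cvg_fst.
  have c2 : (fun yk : (E1 * E2) * (E1 * E2) => yk.2) @ W --> h.
    by apply: cvg_within_filter; exact: cvg_snd.
  have nearD : \forall yk \near W, (U `*` V) yk.1.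
    by rewrite near_withinE; apply: nearW => yk [].
  apply: tvs_cvgD.
    case: (b) wbr => [/(_ isT) wbr|_]; last exact: cvg_cst.
    apply: (jet_cvg jD) => //; rewrite ?size_rcons//.
    + by move=> ?; rewrite !size_rcons.
    + move=> k; apply: cvg_nth_rcons; exact: (cvg_comp _ _ c2 cvg_fst).
    + by move=> k; exact: cvg_cst.
  apply: (jet_cvg jD) => //; rewrite ?size_rcons//.
  + by move=> ?; rewrite !size_rcons.
  + by move=> k; exact: cvg_cst.
  + move=> k; apply: cvg_nth_rcons; exact: (cvg_comp _ _ c2 cvg_snd).
- apply: filterS gamD => t Dt; split=> // nb.
  by rewrite /= (gamb nb) subrr.
Qed.

(** When the directions of the second variable move as well, they are
exchanged one at a time; by linearity each exchange contributes the derivative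
with the difference quotient in the exchanged slot. *)
Lemma jet_chain_slots (b : bool) ws (n : nat) (vs : R -> seq E2)
    (eta : nat -> E2) (gam : R -> E1 * E2) (h : E1 * E2) :
  size ws <=e r -> (b -> (size ws).+1 <=e r) -> n.+1 <=e s ->
  (forall t, size (vs t) = n) ->
  (forall m, (m < n)%N ->
    t^-1 *: (nth 0 (vs t) m - nth 0 (vs 0) m) @[t --> (0 : R)^'] --> eta m) ->
  (U `*` V) (gam 0) -> (\forall t \near (0 : R)^', (U `*` V) (gam t)) ->
  (~~ b -> forall t, (gam t).1 = (gam 0).1) ->
  t^-1 *: (gam t - gam 0) @[t --> (0 : R)^'] --> h ->
  t^-1 *: (D ws (vs t) (gam t) - D ws (vs 0) (gam 0)) @[t --> (0 : R)^'] -->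
    (if b then D (rcons ws h.1) (vs 0) (gam 0) else 0) +
    D ws (rcons (vs 0) h.2) (gam 0) +
    \sum_(m <- iota 0 n)
      D ws (take m (vs 0) ++ eta m :: drop m.+1 (vs 0)) (gam 0).
Proof.
move=> wr wbr ns sz veta D0 gamD gamb gamh.
have n0 : n <=e s by apply: enat_leW ns.
have base := jet_chain wr wbr (vs := vs 0); rewrite sz in base.
have {}base := base _ _ ns D0 gamD gamb gamh.
pose delta m t := t^-1 *: (nth 0 (vs t) m - nth 0 (vs 0) m).
pose swapped m t := D ws (take m (vs t) ++ delta m t :: drop m.+1 (vs 0)) (gam t).
have szm m e t : (m < n)%N -> size (take m (vs t) ++ e :: drop m.+1 (vs 0)) = n.
  by move=> mn; rewrite size_cat /= size_takel ?sz ?(ltnW mn)// size_drop sz -addSnnS subnKC.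
have slots : \sum_(m <- iota 0 n) swapped m t @[t --> (0 : R)^'] -->
    \sum_(m <- iota 0 n) D ws (take m (vs 0) ++ eta m :: drop m.+1 (vs 0)) (gam 0).
  apply: tvs_cvg_sum => m; rewrite mem_iota /= add0n => mn.
  apply: (jet_cvg jD) => //.
  - by rewrite szm.
  - by move=> t; rewrite !szm.
  - exact: cvg_of_quotient gamh.
  - by move=> k; exact: cvg_cst.
  - move=> k; rewrite nth_cat size_takel ?sz ?(ltnW mn)//.
    under eq_fun do rewrite nth_cat size_takel ?sz ?(ltnW mn)//.
    case: ltnP => km.
      rewrite nth_take//; under eq_fun do rewrite nth_take//.
      exact: (cvg_of_quotient (veta k (ltn_trans km mn))).
    case: (k - m)%N => [|i] /=; first exact: veta.
    exact: cvg_cst.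
apply: cvg_trans (tvs_cvgD base slots); apply: near_eq_cvg; near=> t.
have t0 : t != 0 by near: t; exact: nbhs_dnbhs_neq.
have Dt : (U `*` V) (gam t) by near: t.
(* The first [m] slots are already exchanged. *)
pose mix m := D ws (take m (vs t) ++ drop m (vs 0)) (gam t).
have step m : (m < n)%N -> mix m.+1 - mix m = t *: swapped m t.
  move=> mn; rewrite /mix.
  have -> : take m.+1 (vs t) ++ drop m.+1 (vs 0) =
      take m (vs t) ++ (nth 0 (vs 0) m + t *: delta m t) :: drop m.+1 (vs 0).
    rewrite /delta scalerA mulfV// scale1r addrC subrK.
    by rewrite (take_nth 0) ?sz// cat_rcons.
  rewrite (jet_lin hF jD)//; last first.
    by rewrite size_takel ?sz ?(ltnW mn)// size_drop sz -addSn subnKC.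
  by rewrite (drop_nth 0 (n := m)) ?sz// [X in X - _]addrC addrK.
have tel : \sum_(m <- iota 0 n) swapped m t =
    t^-1 *: (D ws (vs t) (gam t) - D ws (vs 0) (gam t)).
  apply: (scalerI t0); rewrite scalerA mulfV// scale1r scaler_sumr.
  transitivity (mix n - mix 0%N).
    rewrite -(@telescope_sumr _ 0 n mix)// /index_iota subn0.
    apply: eq_big_seq => m; rewrite mem_iota /= add0n => mn.
    by rewrite step.
  by rewrite /mix take0 drop0 take_oversize ?sz// drop_oversize ?sz// cats0.
by rewrite tel -scalerDr addrC subrKA.
Unshelve. all: by end_near. Qed.

End JetChain.

(** * The formula of Faa di Bruno *)

Section Terms.
Variables (L1 L2 : eqType).

(** A factor [(I, J)] stands for the derivative of [f] in the directions labelled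
by [I] in [E1] and by [J] in [E2]; a term [(A, M)] stands for the derivative of
[g] in the directions labelled by [A] in [E1] and in the directions of [E3]
given by the factors [M].  Labels, not vectors, are stored, because the same
terms have to represent the derivatives for all directions at once in order
to discuss joint continuity. *)
Definition factor := (seq L1 * seq L2)%type.
Definition term := (seq L1 * seq factor)%type.

Definition dfactor (c : L1 + L2) (fac : factor) : factor :=
  match c with
  | inl l => (rcons fac.1 l, fac.2)
  | inr l => (fac.1, rcons fac.2 l)
  end.

Definition replace_factor (s : seq factor) (m : nat) (fac : factor) : seq factor :=
  take m s ++ fac :: drop m.+1 s.

Definition is_inl (c : L1 + L2) : bool := if c is inl _ then true else false.

Lemma count_is_inl (s1 : seq L1) (s2 : seq L2) :
  count is_inl ([seq inr l | l <- s2] ++ [seq inl l | l <- s1]) = size s1.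
Proof.
rewrite count_cat !count_map (eq_count (a2 := pred0))// count_pred0 add0n.
by rewrite (eq_count (a2 := predT))// count_predT.
Qed.

Lemma count_is_inr (s1 : seq L1) (s2 : seq L2) :
  count (fun c => ~~ is_inl c) ([seq inr l | l <- s2] ++ [seq inl l | l <- s1])
  = size s2.
Proof.
rewrite count_cat !count_map (eq_count (a2 := predT))// count_predT.
by rewrite (eq_count (a2 := pred0))// count_pred0 addn0.
Qed.

(** Chain and product rule: differentiate [g] in its first variable (only in a
direction of [E1]), differentiate [g] in its second variable along the new
factor [d f], or differentiate one of the factors. *)
Definition dterm (c : L1 + L2) (t : term) : seq term :=
  (if c is inl l then [:: (rcons t.1 l, t.2)] else [::]) ++
  (t.1, rcons t.2 (dfactor c ([::], [::]))) ::
  [seq (t.1, replace_factor t.2 m (dfactor c (nth ([::], [::]) t.2 m)))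
     | m <- iota 0 (size t.2)].

Definition dterms (ts : seq term) (c : L1 + L2) : seq term :=
  flatten [seq dterm c t | t <- ts].

Definition fst_weight (s : seq factor) : nat := sumn [seq size fac.1 | fac <- s].
Definition snd_weight (s : seq factor) : nat := sumn [seq size fac.2 | fac <- s].

(** The orders of differentiation that can occur after [n] derivatives in [E1]
and [m] derivatives in [E2]; each derivative adds at most one factor. *)
Definition term_le (n m : nat) (t : term) : bool :=
  [&& (size t.1 + fst_weight t.2 <= n)%N, (snd_weight t.2 <= m)%N &
      (size t.2 <= n + m)%N].

Lemma leq_sumn_mem (s : seq nat) k : k \in s -> (k <= sumn s)%N.
Proof.
elim: s => //= a s IH; rewrite in_cons => /predU1P[->|/IH]; first exact: leq_addr.
by move=> /leq_trans; apply; exact: leq_addl.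
Qed.

Lemma sumn_replace_factor (g : factor -> nat) s m fac d : (m < size s)%N ->
  g fac = (g (nth ([::], [::]) s m) + d)%N ->
  sumn [seq g x | x <- replace_factor s m fac] = (sumn [seq g x | x <- s] + d)%N.
Proof.
move=> ms gE; rewrite /replace_factor map_cat sumn_cat /= gE.
rewrite -[in RHS](cat_take_drop m s) map_cat sumn_cat.
rewrite (drop_nth ([::], [::]) ms) /= -!addnA; congr (_ + (_ + _))%N.
exact: addnC.
Qed.

Lemma fst_weight_replace s m c : (m < size s)%N ->
  fst_weight (replace_factor s m (dfactor c (nth ([::], [::]) s m))) =
  (fst_weight s + is_inl c)%N.
Proof.
move=> ms; apply: sumn_replace_factor => //; case: c => l /=; last by rewrite addn0.
by rewrite size_rcons addn1.
Qed.

Lemma snd_weight_replace s m c : (m < size s)%N ->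
  snd_weight (replace_factor s m (dfactor c (nth ([::], [::]) s m))) =
  (snd_weight s + ~~ is_inl c)%N.
Proof.
move=> ms; apply: sumn_replace_factor => //; case: c => l /=; first by rewrite addn0.
by rewrite size_rcons addn1.
Qed.

Lemma size_replace_factor s m fac : (m < size s)%N -> size (replace_factor s m fac) = size s.
Proof.
move=> ms; rewrite /replace_factor size_cat /= size_takel ?(ltnW ms)// size_drop.
by rewrite -addSnnS subnKC.
Qed.

Lemma fst_weight_rcons s c :
  fst_weight (rcons s (dfactor c ([::], [::]))) = (fst_weight s + is_inl c)%N.
Proof. by rewrite /fst_weight map_rcons sumn_rcons; case: c. Qed.

Lemma snd_weight_rcons s c :
  snd_weight (rcons s (dfactor c ([::], [::]))) = (snd_weight s + ~~ is_inl c)%N.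
Proof. by rewrite /snd_weight map_rcons sumn_rcons; case: c. Qed.

Lemma term_le_dterm n m c t t' : term_le n m t -> t' \in dterm c t ->
  term_le (n + is_inl c) (m + ~~ is_inl c) t'.
Proof.
case: t => A M /and3P[/= h1 h2 h3].
rewrite mem_cat in_cons => /or3P[|/eqP->|/mapP[i]].
- case: c => // l; rewrite mem_seq1 => /eqP-> /=.
  by rewrite /term_le /= size_rcons; apply/and3P; split; lia.
- rewrite /term_le /= fst_weight_rcons snd_weight_rcons size_rcons.
  by case: c => l /=; apply/and3P; split; lia.
- rewrite mem_iota /= add0n => iM ->; rewrite /term_le /= size_replace_factor//.
  rewrite fst_weight_replace// snd_weight_replace//.
  by case: c => l /=; apply/and3P; split; lia.
Qed.

Lemma term_le_factor n m (t : term) fac : term_le n m t -> fac \in t.2 ->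
  (size fac.1 <= n)%N /\ (size fac.2 <= m)%N.
Proof.
move=> /and3P[h1 h2 _] ft; split.
- apply: leq_trans (leq_trans (leq_addl _ _) h1).
  by apply: leq_sumn_mem; exact: (map_f (fun x : factor => size x.1) ft).
- apply: leq_trans h2.
  by apply: leq_sumn_mem; exact: (map_f (fun x : factor => size x.2) ft).
Qed.

End Terms.

Section FaaDiBruno.
Context {R : realType} {E1 E2 E3 E4 : tvsType R}.
Variables (hE3 : hausdorff_space E3) (hE4 : hausdorff_space E4).
Variables (r s k : enat) (hk : enat_le (enat_add r s) k).
Variables (U : set E1) (V : set E2) (P : set E3).
Hypotheses (lcU : locally_convex_subset U) (dU : dense_interior U).
Hypotheses (lcP : locally_convex_subset P) (dP : dense_interior P).
Variables (f : E1 * E2 -> E3) (g : E1 * E3 -> E4).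
Hypothesis fP : set_fun (U `*` V) P f.
Variables (Df : seq E1 -> seq E2 -> E1 * E2 -> E3).
Variables (Dg : seq E1 -> seq E3 -> E1 * E3 -> E4).
Hypotheses (jf : is_jet r s U V f Df) (jg : is_jet r k U P g Dg).
Variables (L1 L2 : eqType).

Definition eval_factor (w : L1 -> E1) (v : L2 -> E2) z (fac : factor L1 L2) : E3 :=
  Df (map w fac.1) (map v fac.2) z.

Definition eval_term w v (t : term L1 L2) z : E4 :=
  Dg (map w t.1) (map (eval_factor w v z) t.2) (z.1, f z).

Definition label_dir (w : L1 -> E1) (v : L2 -> E2) (c : L1 + L2) : E1 * E2 :=
  match c with inl l => (w l, 0) | inr l => (0, v l) end.

Lemma map_label_dir w v (s1 : seq L1) (s2 : seq L2) :
  map (label_dir w v) ([seq inr l | l <- s2] ++ [seq inl l | l <- s1]) =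
  [seq (0, v l) | l <- s2] ++ [seq (w l, 0) | l <- s1].
Proof. by rewrite map_cat -!map_comp. Qed.

Lemma enat_add_le n m : n <=e r -> m <=e s -> (n + m)%N <=e k.
Proof.
move: hk; case: r s k => [a|] [b|] [c|] //= h1 h2 h3.
by apply: leq_trans h1; exact: leq_add.
Qed.

Section EvalCvg.
Context {T : Type} {Fl : set_system T} {FF : Filter Fl}.
Variables (w : T -> L1 -> E1) (v : T -> L2 -> E2) (z : T -> E1 * E2).
Variables (w0 : L1 -> E1) (v0 : L2 -> E2) (z0 : E1 * E2).
Hypotheses (Uz0 : (U `*` V) z0) (Uz : \forall t \near Fl, (U `*` V) (z t)).
Hypotheses (zz0 : z @ Fl --> z0) (ww0 : forall l, w t l @[t --> Fl] --> w0 l).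
Hypothesis (vv0 : forall l, v t l @[t --> Fl] --> v0 l).

Lemma eval_factor_cvg fac : size fac.1 <=e r -> size fac.2 <=e s ->
  eval_factor (w t) (v t) (z t) fac @[t --> Fl] --> eval_factor w0 v0 z0 fac.
Proof.
move=> fr fs; apply: (jet_cvg jf); rewrite ?size_map//.
- by move=> t; rewrite !size_map.
- by move=> t; rewrite !size_map.
- by move=> i; apply: cvg_nth_map.
- by move=> i; apply: cvg_nth_map.
Qed.

Lemma base_map_cvg : f (z t) @[t --> Fl] --> f z0.
Proof.
have := eval_factor_cvg (fac := ([::], [::])) (enat_le0 r) (enat_le0 s).
rewrite {2}/eval_factor /= (jet_nil jf)//; apply: cvg_trans.
by apply: near_eq_cvg; apply: filterS Uz => t Uzt; rewrite /eval_factor (jet_nil jf).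
Qed.

Lemma eval_term_cvg n m t : term_le n m t -> n <=e r -> m <=e s ->
  eval_term (w x) (v x) t (z x) @[x --> Fl] --> eval_term w0 v0 t z0.
Proof.
move=> tle nr ms; have [/= h1 h2 h3] := and3P tle.
apply: (jet_cvg jg); rewrite ?size_map//.
- by apply: enat_leW nr; lia.
- exact: enat_leW h3 (enat_add_le nr ms).
- by split; [case: Uz0|exact: fP].
- by apply: filterS Uz => x Uzx; split; [case: Uzx|exact: fP].
- by move=> x; rewrite !size_map.
- by move=> x; rewrite !size_map.
- by apply: cvg_pair_nbhs; [exact: (cvg_comp _ _ zz0 cvg_fst)|exact: base_map_cvg].
- by move=> i; apply: cvg_nth_map.
- move=> i; apply: cvg_nth_map => fac ft; have [f1 f2] := term_le_factor tle ft.
  by apply: eval_factor_cvg; [exact: enat_leW f1 nr|exact: enat_leW f2 ms].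
Qed.

End EvalCvg.

Variables (w : L1 -> E1) (v : L2 -> E2).
Let O := U° `*` V°.

Let oO : open O.
Proof. by rewrite /O -interior_setX; exact: open_interior. Qed.

Let OUV : O `<=` U `*` V.
Proof. by rewrite /O -interior_setX; exact: interior_subset. Qed.

Lemma eval_factor_dir c fac z : O z ->
  (size fac.1 + is_inl c)%N <=e r -> (size fac.2 + ~~ is_inl c)%N <=e s ->
  has_ddir (eval_factor w v ^~ fac) z (label_dir w v c)
    (eval_factor w v z (dfactor c fac)).
Proof.
move=> Oz; case: c => l /=; rewrite ?addn0 ?addn1 => fr fs;
  rewrite /eval_factor /= map_rcons.
- by apply: (jet_ddir_fst jf); rewrite ?size_map.
- by apply: (jet_ddir_snd hE3 jf); rewrite ?size_map.
Qed.

Lemma base_map_dir c z : O z -> is_inl c <=e r -> ~~ is_inl c <=e s ->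
  has_ddir f z (label_dir w v c)
    (eval_factor w v z (dfactor c ([::], [::]))).
Proof.
move=> Oz cr cs; have := @eval_factor_dir c ([::], [::]) z Oz cr cs.
apply: (has_ddir_open oO Oz) => y /set_mem Oy.
by rewrite /eval_factor (jet_nil jf)//; exact: OUV.
Qed.

(** Along the line through [z], the second argument of [g] and the factors move
on curves whose velocities are derivatives of [f]; the three parts of [dterm]
are the three summands of [jet_chain_slots]. *)
Lemma eval_term_dir n m c t z : O z -> term_le n m t ->
  (n + is_inl c)%N <=e r -> (m + ~~ is_inl c)%N <=e s ->
  has_ddir (eval_term w v t) z (label_dir w v c)
    (\sum_(t' <- dterm c t) eval_term w v t' z).
Proof.
move=> Oz tle nr ms; have [/= h1 h2 h3] := and3P tle.
pose e := label_dir w v c.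
have efst : ~~ is_inl c -> forall x, (z + x *: e).1 = z.1.
  by rewrite /e; case: (c) => // l _ x /=; rewrite scaler0 addr0.
pose vs (x : R) := map (eval_factor w v (z + x *: e)) t.2.
pose gam (x : R) := ((z + x *: e).1, f (z + x *: e)).
pose eta i := eval_factor w v z (dfactor c (nth ([::], [::]) t.2 i)).
pose h := (e.1, eval_factor w v z (dfactor c ([::], [::]))).
have z0 : z + 0 *: e = z by rewrite scale0r addr0.
have zgam x : (U `*` V) (z + x *: e) -> (U `*` P) (gam x).
  by move=> zx; split; [case: zx|exact: fP].
have nr0 : n <=e r by apply: enat_leW nr; exact: leq_addr.
have ms0 : m <=e s by apply: enat_leW ms; exact: leq_addr.
have := @jet_chain_slots R E1 E3 E4 hE4 r k U P g Dg jg lcU dU lcP dP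
  (is_inl c) (map w t.1) (size t.2) vs eta gam h.
rewrite /vs /gam z0 size_map => H.
have {}H := H _ _ _ _ _ _ _ _ _.
have {}H : (fun x : R =>
      x^-1 *: (eval_term w v t (z + x *: e) - eval_term w v t z))
    @ (0 : R)^' --> (if is_inl c then Dg (rcons (map w t.1) h.1)
        (map (eval_factor w v z) t.2) (z.1, f z) else 0) +
      Dg (map w t.1) (rcons (map (eval_factor w v z) t.2) h.2) (z.1, f z) +
      \sum_(i <- iota 0 (size t.2)) Dg (map w t.1)
        (take i (map (eval_factor w v z) t.2) ++ eta i ::
         drop i.+1 (map (eval_factor w v z) t.2)) (z.1, f z).
  apply: H => //.
  - by apply: enat_leW nr0; lia.
  - by move=> b; rewrite b in nr; apply: enat_leW nr; lia.
  - apply: enat_leW (enat_add_le nr ms); case: (is_inl c) => /=; lia.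
  - by move=> x; rewrite size_map.
  - move=> i iM; rewrite (nth_map ([::], [::]))//.
    under eq_fun do rewrite (nth_map ([::], [::]))//.
    have [f1 f2] := term_le_factor tle (mem_nth ([::], [::]) iM).
    apply: eval_factor_dir => //.
      by apply: enat_leW nr; rewrite leq_add2r.
    by apply: enat_leW ms; rewrite leq_add2r.
  - by split; [case: (OUV Oz)|apply: fP; exact: OUV].
  - have := nbhs_line e (open_nbhs_nbhs (conj oO Oz)).
    by apply: filterS => x Ox; apply: zgam; exact: OUV.
  - have := @cvg_pair_quotient R E1 E3 (fun x => (z + x *: e).1)
      (fun x => f (z + x *: e)) e.1 h.2.
    rewrite z0; apply.
      apply: cvg_near_cst; near=> x.
      have x0 : x != 0 by near: x; exact: nbhs_dnbhs_neq.
      by rewrite /= [_ + _ - _]addrAC subrr add0r scalerA mulVf// scale1r.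
    apply: base_map_dir => //.
      by apply: enat_leW nr; lia.
    by apply: enat_leW ms; lia.
have -> : \sum_(t' <- dterm c t) eval_term w v t' z =
    (if is_inl c then Dg (rcons (map w t.1) h.1)
        (map (eval_factor w v z) t.2) (z.1, f z) else 0) +
      Dg (map w t.1) (rcons (map (eval_factor w v z) t.2) h.2) (z.1, f z) +
      \sum_(i <- iota 0 (size t.2)) Dg (map w t.1)
        (take i (map (eval_factor w v z) t.2) ++ eta i ::
         drop i.+1 (map (eval_factor w v z) t.2)) (z.1, f z).
  rewrite /dterm big_cat big_cons big_map /= addrA; congr (_ + _ + _).
  - rewrite /h /e; case: (c) => l; last by rewrite big_nil.
    by rewrite big_seq1 /eval_term /= map_rcons.
  - by rewrite /eval_term /= map_rcons.
  - apply: eq_bigr => i _; rewrite /eval_term /= map_cat map_take /= map_drop.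
    by [].
exact: H.
Unshelve. all: by end_near. Qed.

(** [foldl] follows the order in which [ddirs] processes its directions. *)
Lemma ddirs_terms n m cs (ts : seq (term L1 L2)) (phi : E1 * E2 -> E4) :
  {in ts, forall t, term_le n m t} ->
  (n + count (@is_inl L1 L2) cs)%N <=e r ->
  (m + count (fun c => ~~ is_inl c) cs)%N <=e s ->
  {in O, phi =1 fun z => \sum_(t <- ts) eval_term w v t z} ->
  ddirs_exist O (map (label_dir w v) cs) phi /\
  {in O, ddirs (map (label_dir w v) cs) phi =1
    fun z => \sum_(t <- foldl (@dterms L1 L2) ts cs) eval_term w v t z}.
Proof.
elim: cs n m ts phi => //= c cs IH n m ts phi tle nr ms phiE.
rewrite !addnA in nr ms.
have H z : O z -> has_ddir phi z (label_dir w v c)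
    (\sum_(t <- dterms ts c) eval_term w v t z).
  move=> Oz; have phiE' : {in O, (fun z => \sum_(t <- ts) eval_term w v t z) =1 phi}.
    by move=> y yO; rewrite phiE.
  apply: (has_ddir_open oO Oz phiE').
  rewrite /dterms big_flatten /= big_map; apply: has_ddir_sum => t tts.
  apply: eval_term_dir (tle _ tts) _ _ => //.
    by apply: enat_leW nr; exact: leq_addr.
  by apply: enat_leW ms; exact: leq_addr.
have tle' : {in dterms ts c, forall t, term_le (n + is_inl c) (m + ~~ is_inl c) t}.
  by move=> t' /flattenP[_ /mapP[t tts ->] tt']; exact: term_le_dterm (tle _ tts) tt'.
have phiE' : {in O, ddir (label_dir w v c) phi =1
    fun z => \sum_(t <- dterms ts c) eval_term w v t z}.
  by move=> z /set_mem Oz; apply: ddirE => //; exact: H.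
have [H1 H2] := IH _ _ _ _ tle' nr ms phiE'.
split=> //; split=> // z Oz; exists (\sum_(t <- dterms ts c) eval_term w v t z).
exact: H.
Qed.

Lemma term_le_dterms n m cs (ts : seq (term L1 L2)) :
  {in ts, forall t, term_le n m t} ->
  {in foldl (@dterms L1 L2) ts cs, forall t,
    term_le (n + count (@is_inl L1 L2) cs)
      (m + count (fun c => ~~ is_inl c) cs) t}.
Proof.
elim: cs n m ts => [|c cs IH] n m ts tle /=; first by rewrite !addn0.
rewrite !addnA; apply: IH.
by move=> t' /flattenP[_ /mapP[t tts ->] tt']; exact: term_le_dterm (tle _ tts) tt'.
Qed.

End FaaDiBruno.

Theorem lemma3p19 (R : realType) (E1 E2 E3 E4 : tvsType R)
    (hE1 : hausdorff_space E1) (hE2 : hausdorff_space E2)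
    (hE3 : hausdorff_space E3) (hE4 : hausdorff_space E4)
    (r s k : enat) (hk : enat_le (enat_add r s) k)
    (U : set E1) (V : set E2) (P : set E3)
    (lcU : locally_convex_subset U) (diU : dense_interior U)
    (lcV : locally_convex_subset V) (diV : dense_interior V)
    (lcP : locally_convex_subset P) (diP : dense_interior P)
    (f : E1 * E2 -> E3) (g : E1 * E3 -> E4)
    (fP : set_fun (U `*` V) P f)
    (fC : Crs r s U V f) (gC : Crs r k U P g) :
  Crs r s U V (fun z : E1 * E2 => g (z.1, f z)).
Proof.
have [Df jf] := Crs_jet fC; have [Dg jg] := Crs_jet gC.
set h := fun z : E1 * E2 => g (z.1, f z).
have OUV : U° `*` V° `<=` U `*` V.
  by rewrite -interior_setX; exact: interior_subset.
(* The labels in the order of [dirs]. *)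
pose cs i j : seq ('I_i + 'I_j) :=
  [seq inr l | l <- enum 'I_j] ++ [seq inl l | l <- enum 'I_i].
have cs_fst i j : count (@is_inl _ _) (cs i j) = i.
  by rewrite /cs count_is_inl size_enum_ord.
have cs_snd i j : count (fun c => ~~ is_inl c) (cs i j) = j.
  by rewrite /cs count_is_inr size_enum_ord.
pose ts i j := foldl (@dterms _ _) [:: ([::], [::])] (cs i j).
have ts_le i j : {in ts i j, forall t, term_le i j t}.
  move=> t tt; have := @term_le_dterms _ _ 0%N 0%N (cs i j) [:: ([::], [::])] _ t tt.
  rewrite cs_fst cs_snd; apply => t'; rewrite mem_seq1 => /eqP->.
  by [].
pose d i j (p : E1 * E2 * tpow E1 i * tpow E2 j) : E4 :=
  \sum_(t <- ts i j) eval_term f Df Dg p.1.2 p.2 t p.1.1.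
have init_le i j : {in [:: ([::], [::])], forall t : term 'I_i 'I_j, term_le 0 0 t}.
  by move=> t; rewrite mem_seq1 => /eqP->.
have hE i j (w : tpow E1 i) (v : tpow E2 j) z : (U `*` V) z ->
    h z = \sum_(t <- [:: ([::], [::])]) eval_term f Df Dg w v t z.
  move=> Uz; rewrite big_seq1 /eval_term /= (jet_nil jg)//.
  by split; [case: Uz|exact: fP].
have derivs i j (w : tpow E1 i) (v : tpow E2 j) :
    enat_le (ENat i) r -> enat_le (ENat j) s ->
    ddirs_exist (U° `*` V°) (dirs w v) h /\
    {in U° `*` V°, forall z, ddirs (dirs w v) h z = d i j (z, w, v)}.
  move=> ir js; have := @ddirs_terms R E1 E2 E3 E4 hE3 hE4 r s k hk U V P
    lcU diU lcP diP f g fP Df Dg jf jg _ _ w v 0%N 0%N (cs i j)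
    [:: ([::], [::])] h (init_le i j).
  rewrite !add0n cs_fst cs_snd => /(_ ir js).
  have -> : map (label_dir w v) (cs i j) = dirs w v.
    exact: map_label_dir.
  by apply => z /set_mem /OUV Uz; exact: hE.
have dcont i j : enat_le (ENat i) r -> enat_le (ENat j) s ->
    {within dij_dom U V, continuous (d i j)}.
  move=> ir js; apply/subspace_continuousP => -[[z w] v] [[Uz _] _].
  set Fl := within _ _.
  have fst_cvg (X Y : topologicalType) (a : X) (b : Y) :
      fst @ nbhs (a, b) --> a by exact: cvg_fst.
  have snd_cvg (X Y : topologicalType) (a : X) (b : Y) :
      snd @ nbhs (a, b) --> b by exact: cvg_snd.
  apply: tvs_cvg_sum => t tt.
  apply: (eval_term_cvg hk fP jf jg) (ts_le i j t tt) ir js => //.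
  - by rewrite near_withinE; apply: nearW => -[[z' w'] v'] [[]].
  - apply: cvg_within_filter.
    exact: (@cvg_comp _ _ _ fst fst _ _ _ (fst_cvg _ _ (z, w) v) (fst_cvg _ _ z w)).
  - move=> l; apply: cvg_within_filter.
    apply: (@cvg_comp _ _ _ (fun p => p.1.2) (@proj _ (fun=> E1) l)).
      exact: (@cvg_comp _ _ _ fst snd _ _ _ (fst_cvg _ _ (z, w) v) (snd_cvg _ _ z w)).
    exact: (@proj_continuous 'I_i (fun=> E1) l w).
  - move=> l; apply: cvg_within_filter.
    apply: (@cvg_comp _ _ _ snd (@proj _ (fun=> E2) l)).
      exact: (snd_cvg _ _ (z, w) v).
    exact: (@proj_continuous 'I_j (fun=> E2) l v).
have dE i j : enat_le (ENat i) r -> enat_le (ENat j) s ->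
    {in dij_dom U° V°, d i j =1 @dij R E1 E2 E4 i j h}.
  move=> ir js [[z w] v] /set_mem[[Oz _] _]; rewrite /dij /=.
  by have [_ ->] := derivs i j w v ir js; last exact/mem_set.
split=> i j ir js.
  split; first by move=> w v; have [] := derivs i j w v ir js.
  apply: subspace_eq_continuous (dE i j ir js) _.
  apply: continuous_subspaceW (dcont i j ir js).
  by move=> [[z w] v] [[Oz _] _]; split => //; split => //; exact: OUV.
exists (d i j); split; [exact: dcont|exact: dE|].
move=> i0 j0; subst i j => -[[z w] v] /set_mem[[Uz _] _].
(* For [i = j = 0] the only term is the one representing [g (x, f (x, y))]. *)
have cs00 : cs 0%N 0%N = [::].
  have -> : cs 0%N 0%N = map inr (enum 'I_0) ++ map inl (enum 'I_0) by [].
  by rewrite (size0nil (size_enum_ord 0)).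
by rewrite /d /ts cs00 /= -hE.
Qed.
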